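(* For $\delta,\omega>0$ let $\Theta_\omega$ be the solution of $\ddot{\Theta}_\omega+\frac1\omega\Theta_\omega+\frac1\omega\Theta_\omega^3=0$, $\Theta_\omega(0)=\delta$, $\dot\Theta_\omega(0)=0$, and consider the Hill equation $$\ddot{\xi}(t)+\big(\omega+\Theta_\omega(t)^2\big)\xi(t)=0 .$$ The resonant tongue $U_1$ of this equation emanating from $(\delta,\omega)=(0,1)$ is given by $$U_1=\big\{(\delta,\omega)\in\mathbb{R}^2_+ :\ 1<\omega<\phi(\delta)\big\},$$ where $\phi:\mathbb{R}_+\to\mathbb{R}_+$ is a continuous function such that $$\phi(\delta)>1\quad\forall\delta>0,\qquad \phi(\delta)\le 1+\Big(\frac18+\frac1{2\pi}\Big)\delta^2+O(\delta^4)\ \text{ as }\delta\to0,\qquad \lim_{\delta\to\infty}\phi(\delta)=3 .$$ Moreover, the strip $(0,\infty)\times(0,1)$ is a stability region of the $(\delta,\omega)$-plane, that is, the trivial solution of the Hill equation is stable for all $\delta>0$ and $0<\omega<1$.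
   Context: $\mathbb{R}_+=(0,\infty)$, $\mathbb{R}^2_+=(0,\infty)^2$. The solution $\Theta_\omega$ (which depends on $\delta$ and $\omega$) is periodic with some minimal period $T_\omega(\delta)$, and $\Theta_\omega^2$ has minimal period $\tau=T_\omega(\delta)/2$; moreover $T_\omega(\delta)\to2\pi\sqrt\omega$ as $\delta\to0$. The trivial solution of the Hill equation is called stable if all its solutions are bounded on $\mathbb{R}$, and unstable otherwise. The monodromy matrix $M(\delta,\omega)$ is the value at $t=\tau$ of the fundamental matrix (of the associated first order system) which is the identity at $t=0$. For an integer $\ell\ge1$, the resonant tongue $U_\ell$ emanating from $(\delta,\omega)=(0,\ell)$ is the $\ell$-th (open) instability region in the parameter plane: the set of $(\delta,\omega)\in\mathbb{R}^2_+$ such that $|\operatorname{tr}M(\delta,\omega)|>2$ and such that the nontrivial real solutions satisfying $\xi(t+\tau)=\mu\,\xi(t)$ for all $t$ (with $\mu$ a real eigenvalue of $M(\delta,\omega)$) have exactly $\ell$ zeros in $[0,\tau)$. The inequality with $O(\delta^4)$ means that there are constants $C,\delta_0>0$ such that $\phi(\delta)\le 1+(\frac18+\frac1{2\pi})\delta^2+C\delta^4$ for $0<\delta<\delta_0$. *)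

(* Defs.v *)
(* Stdlib reals with Coquelicot derivatives, limits and matrices. *)
From Stdlib Require Import Reals List.
From Coquelicot Require Import Coquelicot.
Open Scope R_scope.

(* [Derive] and [Derive_n] are total functions, so differentiability has to be
   required separately wherever they appear in a differential equation. *)
Definition twice_derivable (f : R -> R) : Prop :=
  forall t : R, ex_derive f t /\ ex_derive (Derive f) t.

Definition duffing_solution (delta omega : R) (Theta : R -> R) : Prop :=
  twice_derivable Theta /\
  (forall t : R,
     Derive_n Theta 2 t + / omega * Theta t + / omega * Theta t ^ 3 = 0) /\
  Theta 0 = delta /\
  Derive Theta 0 = 0.

Definition minimal_period (f : R -> R) (T : R) : Prop :=
  0 < T /\
  (forall t : R, f (t + T) = f t) /\
  (forall S : R, 0 < S -> (forall t : R, f (t + S) = f t) -> T <= S).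

Definition hill_potential (omega : R) (Theta : R -> R) (t : R) : R :=
  omega + Theta t ^ 2.

Definition hill_solution (q xi : R -> R) : Prop :=
  twice_derivable xi /\ forall t : R, Derive_n xi 2 t + q t * xi t = 0.

Definition stable (q : R -> R) : Prop :=
  forall xi : R -> R, hill_solution q xi ->
    exists B : R, forall t : R, Rabs (xi t) <= B.

(* The Hill equation as the system [(xi, xi')' = A(t) (xi, xi')]. *)
Definition hill_system (q : R -> R) (t : R) : @matrix R 2 2 :=
  mk_matrix 2 2 (fun i j =>
    match i, j with
    | O, S O => 1
    | S O, O => - q t
    | _, _ => 0
    end).

Definition fundamental_matrix (q : R -> R) (Y : R -> @matrix R 2 2) : Prop :=
  Y 0 = Mone /\
  forall (t : R) (i j : nat), (i < 2)%nat -> (j < 2)%nat ->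
    is_derive (fun s : R => coeff_mat 0 (Y s) i j) t
              (coeff_mat 0 (Mmult (hill_system q t) (Y t)) i j).

Definition trace2 (M : @matrix R 2 2) : R :=
  coeff_mat 0 M 0 0 + coeff_mat 0 M 1 1.

Definition real_eigenvalue (M : @matrix R 2 2) (mu : R) : Prop :=
  exists v : @matrix R 2 1,
    v <> Mzero /\
    Mmult M v = mk_matrix 2 1 (fun i j => mu * coeff_mat 0 v i j).

Definition exactly_n_zeros (f : R -> R) (a b : R) (n : nat) : Prop :=
  exists l : list R,
    NoDup l /\ length l = n /\
    forall t : R, In t l <-> (a <= t < b /\ f t = 0).

(* [Theta delta omega] is the Duffing solution with these parameters.  The
   monodromy matrix is [Y tau], with [tau = T / 2] the minimal period of
   [(Theta delta omega)^2].  Both [T] and [Y] are unique, and when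
   [2 < |tr (Y tau)|] real eigenvalues and the corresponding Floquet solutions
   exist, so the universally quantified zero count is not vacuous. *)
Definition resonant_tongue (Theta : R -> R -> R -> R) (ell : nat)
    (delta omega : R) : Prop :=
  0 < delta /\ 0 < omega /\
  exists (T : R) (Y : R -> @matrix R 2 2),
    let q := hill_potential omega (Theta delta omega) in
    let tau := T / 2 in
    minimal_period (Theta delta omega) T /\
    fundamental_matrix q Y /\
    2 < Rabs (trace2 (Y tau)) /\
    forall (mu : R) (xi : R -> R),
      real_eigenvalue (Y tau) mu ->
      hill_solution q xi ->
      (exists t : R, xi t <> 0) ->
      (forall t : R, xi (t + tau) = mu * xi t) ->
      exactly_n_zeros xi 0 tau ell.

(* Main.v *)
Require Import Defs.
From Stdlib Require Import Reals List.
From Stdlib Require Import Ranalysis5 Factorial Lra Lia.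
From Coquelicot Require Import Coquelicot.
Open Scope R_scope.

(** In the time variable [s = t / sqrt w] the Duffing orbit [u] no longer depends on [w], and the
    Hill equation becomes [y'' + (w ^ 2 + w * u ^ 2) y = 0], whose potential increases with [w].
    Let [A] be the quarter period of [u] and let [c], [s] be the solutions with initial data
    [(1, 0)] and [(0, 1)].  By symmetry about [0] and [A], half the trace of the monodromy matrix
    is [2 c(A) s'(A) - 1 = 1 + 2 c'(A) s(A)].  At [w = 1] one has [c = u / d], so [c(A) = 0]; by
    Sturm comparison [c > 0] on [[0, A]] for [w < 1], and [c] has a zero in [(0, A)] for [w > 1].
    The other edge [phi] of the tongue is the supremum of the [w] for which [s' > 0] on [[0, A]].
    Between the two edges [c(A) < 0 < s'(A)], and [s > 0] on [(0, 2 A]] leaves room for one zero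
    of a Floquet solution; beyond [phi] either the trace is [-2] or Floquet solutions with exactly
    one zero are excluded by separation and sign-change arguments.

    The estimates on [phi] come from explicit sub- and supersolutions: [v = - u'] solves the
    equation with potential [1 + 3 u ^ 2], and [v (1 - k u ^ 2)] with
    [k = (w ^ 2 - 1) / (2 E)], where [E = d ^ 2 + d ^ 4 / 2 = u' ^ 2 + u ^ 2 + u ^ 4 / 2], is a
    subsolution for [w = 1 + E / 4] and small [d], and a supersolution for [w < 3] and large [d]. *)

(** The sine edge is defined by positivity of [s'] on the whole of [[0, A]] and not by [s'(A) = 0]:
    for larger [w] the value [s'(A)] becomes positive again, whereas the positivity condition, once
    lost, stays lost by Sturm comparison. Positivity on [[0, A]] survives small changes of [(d, w)],
    and strictly beyond the edge so does a point of [(0, A)] with [s' < 0]; this makes [phi]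
    continuous. The obstacle is that [A] moves with [d], so both conditions are first transported to
    an interval that does not depend on [d]. The limit 3 is the [w] at which [w ^ 2 + w * u ^ 2] and
    [1 + 3 * u ^ 2] have the same coefficient of [u ^ 2], which dominates at large amplitude. For
    small [d], [E / 4] is to leading order the value of [w - 1] at which the coefficient of [u ^ 2]
    in the defect of the corrected test function becomes nonnegative. The bound
    [1 + d ^ 2 / 4 + d ^ 4 / 8] so obtained suffices because [1 / 8 <= 1 / (2 * PI)]. *)

(** * Calculus on the line: monotonicity, sign changes, first zeros *)

Lemma MVT_is_derive (f df : R -> R) (a b : R) :
  a < b -> (forall t, a <= t <= b -> is_derive f t (df t)) ->
  exists c, a < c < b /\ f b - f a = df c * (b - a).
Proof.
  intros Hab Hd.
  destruct (MVT_cor2 f df a b Hab) as [c [H1 H2]].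
  - intros c Hc. apply is_derive_Reals. now apply Hd.
  - now exists c.
Qed.

Lemma derive_pos_incr (f df : R -> R) (a b : R) :
  a < b -> (forall t, a <= t <= b -> is_derive f t (df t)) ->
  (forall t, a < t < b -> 0 < df t) -> f a < f b.
Proof.
  intros Hab Hd Hp.
  destruct (MVT_is_derive f df a b Hab Hd) as [c [Hc E]].
  specialize (Hp c Hc). nra.
Qed.

Lemma derive_neg_decr (f df : R -> R) (a b : R) :
  a < b -> (forall t, a <= t <= b -> is_derive f t (df t)) ->
  (forall t, a < t < b -> df t < 0) -> f b < f a.
Proof.
  intros Hab Hd Hp.
  destruct (MVT_is_derive f df a b Hab Hd) as [c [Hc E]].
  specialize (Hp c Hc). nra.
Qed.

Lemma derive_nonpos_decr (f df : R -> R) (a b : R) :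
  a <= b -> (forall t, a <= t <= b -> is_derive f t (df t)) ->
  (forall t, a < t < b -> df t <= 0) -> f b <= f a.
Proof.
  intros [Hab | <-] Hd Hp; [|lra].
  destruct (MVT_is_derive f df a b Hab Hd) as [c [Hc E]].
  specialize (Hp c Hc). nra.
Qed.

Lemma derive_0_const (f : R -> R) :
  (forall t, is_derive f t 0) -> forall a b, f a = f b.
Proof.
  assert (H : forall a b, a < b -> (forall t, is_derive f t 0) -> f a = f b).
  { intros a b Hab Hd.
    destruct (MVT_is_derive f (fun _ => 0) a b Hab) as [c [_ E]]; [now intros|lra]. }
  intros Hd a b. destruct (Rtotal_order a b) as [L | [E | L]].
  - now apply H.
  - now subst.
  - symmetry. now apply H.
Qed.

Lemma is_derive_continuity_pt (f : R -> R) (t l : R) :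
  is_derive f t l -> continuity_pt f t.
Proof.
  intros H. apply continuity_pt_filterlim.
  apply (ex_derive_continuous f). now exists l.
Qed.

Lemma IVT_strict (f : R -> R) (a b : R) :
  a < b -> (forall t, a <= t <= b -> continuity_pt f t) ->
  f a * f b < 0 -> exists c, a < c < b /\ f c = 0.
Proof.
  intros Hab Hc Hs.
  assert (H : exists c, a <= c <= b /\ f c = 0).
  { destruct (Rlt_or_le (f a) 0) as [Ha | Ha].
    - assert (0 < f b) by nra.
      destruct (IVT_interv f a b Hc Hab Ha H) as [c Hc']. exists c; tauto.
    - assert (f b < 0) by nra. assert (0 < f a) by nra.
      destruct (IVT_interv (fun x => - f x) a b) as [c Hc']; try lra.
      + intros t Ht. apply (continuity_pt_opp f). now apply Hc.
      + exists c. split; [tauto|lra]. }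
  destruct H as [c [[[H1 | <- ] [H2 | -> ]] E]]; try (exists c; tauto);
    rewrite E in Hs; lra.
Qed.

Lemma first_zero (f : R -> R) (a b : R) :
  a <= b -> (forall t, a <= t <= b -> continuity_pt f t) ->
  0 < f a -> f b <= 0 ->
  exists c, a < c <= b /\ f c = 0 /\ forall t, a <= t < c -> 0 < f t.
Proof.
  intros Hab Hc Ha Hb.
  (* The zero is the supremum of the points up to which [f] stays positive. A negative value there
     contradicts positivity just before it; a positive value would push the supremum further. *)
  set (E := fun x => a <= x <= b /\ forall t, a <= t <= x -> 0 < f t).
  destruct (completeness E) as [c [Hub Hlub]].
  - exists b. intros x [Hx _]. lra.
  - exists a. split; [lra|]. intros t Ht. now replace t with a by lra.
  - assert (Hac : a <= c).
    { apply Hub. split; [lra|]. intros t Ht. now replace t with a by lra. }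
    assert (Hcb : c <= b) by (apply Hlub; intros x [Hx _]; lra).
    assert (Hpos : forall t, a <= t < c -> 0 < f t).
    { intros t Ht. destruct (Rlt_or_le 0 (f t)) as [|Hn]; [easy|exfalso].
      assert (c <= t); [|lra]. apply Hlub. intros x [Hx Hx'].
      destruct (Rle_or_lt x t) as [|L]; [easy|].
      specialize (Hx' t). lra. }
    assert (Hloc : forall e, f c = e -> e <> 0 -> exists d, 0 < d /\
              forall t, Rabs (t - c) < d -> Rabs (f t - f c) < Rabs e).
    { intros e He He0. specialize (Hc c (conj Hac Hcb)).
      destruct (Hc (Rabs e)) as [d [Hd Hd']]; [now apply Rabs_pos_lt|].
      exists d. split; [easy|]. intros t Ht.
      destruct (Req_dec t c) as [->|Hne].
      - rewrite Rminus_diag, Rabs_R0. now apply Rabs_pos_lt.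
      - apply Hd'. repeat split; auto. }
    destruct (Rtotal_order (f c) 0) as [Hn | [Hz | Hp]].
    + exfalso. destruct (Hloc _ eq_refl) as [d [Hd Hd']]; [lra|].
      assert (a < c) by (destruct Hac as [|Q]; [easy|rewrite <- Q in Hn; lra]).
      set (t := Rmax a (c - d / 2)).
      assert (a <= t < c) by (unfold t, Rmax; destruct Rle_dec; lra).
      assert (c - d / 2 <= t) by apply Rmax_r.
      specialize (Hpos t H0).
      specialize (Hd' t). rewrite (Rabs_left (f c)) in Hd' by easy.
      rewrite (Rabs_left1 (t - c)) in Hd' by lra.
      specialize (Hd' ltac:(lra)). apply Rabs_def2 in Hd'. lra.
    + exists c. repeat split; auto.
      destruct Hac as [|Q]; [easy|rewrite <- Q in Hz; lra].
    + exfalso. destruct (Hloc _ eq_refl) as [d [Hd Hd']]; [lra|].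
      rewrite (Rabs_right (f c)) in Hd' by lra.
      assert (c < b) by (destruct Hcb as [|Q]; [easy|rewrite Q in Hp; lra]).
      set (x := Rmin b (c + d / 2)).
      assert (c < x <= b) by (unfold x, Rmin; destruct Rle_dec; lra).
      assert (x <= c + d / 2) by apply Rmin_r.
      assert (x <= c); [|lra]. apply Hub. split; [lra|].
      intros t Ht. destruct (Rlt_or_le t c) as [L|L]; [apply Hpos; lra|].
      specialize (Hd' t). rewrite Rabs_right in Hd' by lra.
      specialize (Hd' ltac:(lra)). apply Rabs_def2 in Hd'. lra.
Qed.

(** * Linear second order equations *)

(** Carrying the derivative as a second function makes this a first order system, so that shifts,
    reflections and combinations act on pairs without any mention of [Derive]. *)
Definition sol (q y z : R -> R) : Prop :=
  forall t, is_derive y t (z t) /\ is_derive z t (- q t * y t).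

Lemma Derive_eta (f : R -> R) (t l : R) :
  is_derive f t l -> Derive (fun x : R => f x) t = l.
Proof. apply is_derive_unique. Qed.

Lemma sol_lincomb (q y z v w : R -> R) (a b : R) :
  sol q y z -> sol q v w ->
  sol q (fun t => a * y t + b * v t) (fun t => a * z t + b * w t).
Proof.
  intros H1 H2 t.
  destruct (H1 t) as [Hy Hz], (H2 t) as [Hv Hw].
  split.
  - apply (is_derive_plus (fun t => a * y t) (fun t => b * v t));
    [apply (is_derive_scal y)|apply (is_derive_scal v)]; easy.
  - replace (- q t * (a * y t + b * v t)) with (a * (- q t * y t) + b * (- q t * v t)) by ring.
    apply (is_derive_plus (fun t => a * z t) (fun t => b * w t));
    [apply (is_derive_scal z)|apply (is_derive_scal w)]; easy.
Qed.

Lemma is_derive_affine (f df : R -> R) (a b t : R) :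
  is_derive f (a * t + b) (df (a * t + b)) ->
  is_derive (fun t => f (a * t + b)) t (a * df (a * t + b)).
Proof.
  intros H.
  apply (is_derive_comp f (fun t => a * t + b) t).
  - exact H.
  - auto_derive; [easy|ring].
Qed.

Lemma sol_affine (q y z : R -> R) (a b : R) :
  sol q y z ->
  sol (fun t => a ^ 2 * q (a * t + b)) (fun t => y (a * t + b))
      (fun t => a * z (a * t + b)).
Proof.
  intros H t. destruct (H (a * t + b)) as [Hy Hz]. split.
  - now apply (is_derive_affine y z).
  - replace (- (a ^ 2 * q (a * t + b)) * y (a * t + b))
      with (a * (a * (- q (a * t + b) * y (a * t + b)))) by ring.
    apply (is_derive_scal (fun t => z (a * t + b))).
    now apply (is_derive_affine z (fun t => - q t * y t)).
Qed.

Lemma sol_ext (q q' y y' z z' : R -> R) :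
  (forall t, q t = q' t) -> (forall t, y t = y' t) -> (forall t, z t = z' t) ->
  sol q y z -> sol q' y' z'.
Proof.
  intros Hq Hy Hz H t. destruct (H t) as [H1 H2].
  rewrite <- Hz, <- Hq, <- Hy. split.
  - now apply (is_derive_ext y).
  - now apply (is_derive_ext z).
Qed.

Lemma sol_continuity (q y z : R -> R) (t : R) :
  sol q y z -> continuity_pt y t /\ continuity_pt z t.
Proof.
  intros H. destruct (H t). split; eapply is_derive_continuity_pt; eauto.
Qed.

(** The quantity [(d ^ 2 + e ^ 2 + eps ^ 2) * exp (- (M + 2) * t)] is nonincreasing: the cross term
    [2 * (1 - a) * d * e] costs at most [1 + M] times [d ^ 2 + e ^ 2], and the forcing [2 * e * f]
    at most [e ^ 2 + eps ^ 2]. Taking [f = 0] gives uniqueness; a nonzero [f] compares solutions for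
    two different potentials. *)
Lemma gronwall (d e a f : R -> R) (M eps L : R) :
  (forall t, 0 <= t <= L -> is_derive d t (e t)) ->
  (forall t, 0 <= t <= L -> is_derive e t (- a t * d t + f t)) ->
  (forall t, 0 <= t <= L -> Rabs (a t) <= M) ->
  (forall t, 0 <= t <= L -> Rabs (f t) <= eps) ->
  0 <= M -> 
  forall t, 0 <= t <= L ->
  d t ^ 2 + e t ^ 2 <= (d 0 ^ 2 + e 0 ^ 2 + eps ^ 2) * exp ((M + 2) * t).
Proof.
  intros Hd He Ha Hf HM t Ht.
  set (G := fun t => (d t ^ 2 + e t ^ 2 + eps ^ 2) * exp (- (M + 2) * t)).
  set (dG := fun t => (2 * d t * e t + 2 * e t * (- a t * d t + f t)
                - (M + 2) * (d t ^ 2 + e t ^ 2 + eps ^ 2)) * exp (- (M + 2) * t)).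
  assert (HG : G t <= G 0).
  { apply (derive_nonpos_decr G dG); [lra| |].
    - intros x Hx. specialize (Hd x ltac:(lra)). specialize (He x ltac:(lra)).
      unfold G, dG. auto_derive.
      + split; [eexists; eassumption|split; [eexists; eassumption|easy]].
      + rewrite (Derive_eta d x _ Hd), (Derive_eta e x _ He). ring.
    - intros x Hx. specialize (Ha x ltac:(lra)). specialize (Hf x ltac:(lra)).
      unfold dG. pose proof (exp_pos (- (M + 2) * x)).
      match goal with |- ?A * _ <= 0 => assert (A <= 0); [clear H|nra] end.
      apply Rabs_le_between in Ha. apply Rabs_le_between in Hf.
      assert (2 * e x * f x <= e x ^ 2 + eps ^ 2).
      { assert (f x ^ 2 <= eps ^ 2) by nra. pose proof (pow2_ge_0 (e x - f x)). nra. }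
      assert (2 * (1 - a x) * (d x * e x) <= (1 + M) * (d x ^ 2 + e x ^ 2)).
      { pose proof (pow2_ge_0 (d x + e x)); pose proof (pow2_ge_0 (d x - e x)).
        set (S := d x ^ 2 + e x ^ 2). set (X := 2 * (d x * e x)).
        assert (0 <= (1 + M - (1 - a x)) * (S + X)) by (apply Rmult_le_pos; unfold S, X; lra).
        assert (0 <= (1 + M + (1 - a x)) * (S - X)) by (apply Rmult_le_pos; unfold S, X; lra).
        replace (2 * (1 - a x) * (d x * e x)) with ((1 - a x) * X) by (unfold X; ring).
        nra. }
      pose proof (Rmult_le_pos _ _ HM (pow2_ge_0 eps)).
      pose proof (pow2_ge_0 (d x)). pose proof (pow2_ge_0 eps). lra. }
  unfold G in HG. rewrite Rmult_0_r, exp_0 in HG.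
  assert (HE : exp (- (M + 2) * t) * exp ((M + 2) * t) = 1).
  { rewrite <- exp_plus, <- exp_0. f_equal. ring. }
  pose proof (exp_pos ((M + 2) * t)).
  apply (Rmult_le_compat_r (exp ((M + 2) * t))) in HG; [|lra].
  rewrite Rmult_assoc, HE, !Rmult_1_r in HG.
  pose proof (pow2_ge_0 eps). lra.
Qed.

(** This is [gronwall] with zero data and no forcing, which only looks forward from 0. A translation
    moves [t0] to 0, and times before [t0] are reached through the reflection [t0 - t]. *)
Lemma sol_zero (q y z : R -> R) (M t0 : R) :
  (forall t, Rabs (q t) <= M) -> sol q y z -> y t0 = 0 -> z t0 = 0 ->
  forall t, y t = 0 /\ z t = 0.
Proof.
  intros HM H Hy Hz.
  assert (HM0 : 0 <= M) by (eapply Rle_trans; [apply Rabs_pos|apply (HM 0)]).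
  assert (F : forall q y z, (forall t, Rabs (q t) <= M) -> sol q y z ->
     y 0 = 0 -> z 0 = 0 -> forall t, 0 <= t -> y t = 0 /\ z t = 0).
  { clear. intros q y z HM H Hy Hz t Ht.
    assert (HM0 : 0 <= M) by (eapply Rle_trans; [apply Rabs_pos|apply (HM 0)]).
    assert (G := gronwall y z q (fun _ => 0) M 0 t).
    specialize (G (fun s _ => proj1 (H s))).
    assert (y t ^ 2 + z t ^ 2 <= 0).
    { rewrite Hy, Hz in G. 
      replace 0 with ((0 ^ 2 + 0 ^ 2 + 0 ^ 2) * exp ((M + 2) * t)) by ring.
      apply G; auto; try lra.
      - intros s _. rewrite Rplus_0_r. apply H.
      - intros s _. rewrite Rabs_R0. lra. }
    pose proof (pow2_ge_0 (y t)). pose proof (pow2_ge_0 (z t)).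
    split; apply Rsqr_0_uniq; unfold Rsqr; lra. }
  intros t. destruct (Rle_or_lt t0 t) as [L|L].
  - assert (S1 := sol_affine q y z 1 t0 H).
    apply F with (t := t - t0) in S1; try lra.
    + replace (1 * (t - t0) + t0) with t in S1 by ring. lra.
    + intros s. replace (1 ^ 2 * q (1 * s + t0)) with (q (1 * s + t0)) by ring. apply HM.
    + rewrite Rmult_0_r, Rplus_0_l. easy.
    + rewrite Rmult_0_r, Rplus_0_l, Hz. ring.
  - assert (S1 := sol_affine q y z (-1) t0 H).
    apply F with (t := t0 - t) in S1; try lra.
    + replace (-1 * (t0 - t) + t0) with t in S1 by ring. lra.
    + intros s. replace ((-1) ^ 2 * q (-1 * s + t0)) with (q (-1 * s + t0)) by ring. apply HM.
    + rewrite Rmult_0_r, Rplus_0_l. easy.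
    + rewrite Rmult_0_r, Rplus_0_l, Hz. ring.
Qed.

Lemma sol_unique (q y z v w : R -> R) (M t0 : R) :
  (forall t, Rabs (q t) <= M) -> sol q y z -> sol q v w ->
  y t0 = v t0 -> z t0 = w t0 ->
  forall t, y t = v t /\ z t = w t.
Proof.
  intros HM H1 H2 Hy Hz t.
  destruct (sol_zero q _ _ M t0 HM (sol_lincomb q y z v w 1 (-1) H1 H2)) with (t := t); lra.
Qed.

(** * Existence of solutions by Picard iteration *)

Section Picard.

Variables (q : R -> R) (M a b : R).
Hypothesis Hq : forall t, continuous q t.
Hypothesis HM : forall t, Rabs (q t) <= M.

(** These are the terms of the Picard series, not its partial sums: each term integrates the
    previous one from the initial value 0, and the data [a], [b] enter through term 0 alone. *)
Fixpoint picard (n : nat) : (R -> R) * (R -> R) :=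
  match n with
  | O => (fun _ => a, fun _ => b)
  | S n => (fun t => RInt (snd (picard n)) 0 t,
            fun t => RInt (fun r => - q r * fst (picard n) r) 0 t)
  end.

Lemma is_derive_RInt_continuous (f : R -> R) (t : R) :
  (forall t, continuous f t) -> is_derive (fun t => RInt f 0 t) t (f t).
Proof.
  intros Hf. apply (is_derive_RInt f _ 0 t); [|apply Hf].
  apply filter_forall. intros x. apply (@RInt_correct R_CompleteNormedModule).
  apply (@ex_RInt_continuous R_CompleteNormedModule). intros; apply Hf.
Qed.

Lemma picard_continuous (n : nat) (t : R) :
  continuous (fst (picard n)) t /\ continuous (snd (picard n)) t.
Proof.
  revert t. induction n as [|n IH]; intros t; simpl.
  - split; apply continuous_const.
  - split; apply (ex_derive_continuous (V := R_NormedModule)); eexists;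
      apply is_derive_RInt_continuous; intros x.
    + apply IH.
    + apply (continuous_mult (fun r => - q r) (fst (picard n))); [|apply IH].
      now apply (continuous_opp q).
Qed.

Lemma picard_derive (n : nat) (t : R) :
  is_derive (fst (picard (S n))) t (snd (picard n) t) /\
  is_derive (snd (picard (S n))) t (- q t * fst (picard n) t).
Proof.
  split; simpl.
  - apply is_derive_RInt_continuous. intros; apply (picard_continuous n).
  - apply (is_derive_RInt_continuous (fun r => - q r * fst (picard n) r)).
    intros x. apply (continuous_mult (fun r => - q r) (fst (picard n))).
    + now apply (continuous_opp q).
    + intros; apply (picard_continuous n).
Qed.

(** For [t >= 0] both [f] and [- f] are compared with the antiderivative of the bound; negative [t]
    follow by reflection. *)
Lemma abs_le_of_derive (f df : R -> R) (C : R) (n : nat) :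
  f 0 = 0 -> (forall t, is_derive f t (df t)) ->
  (forall t, Rabs (df t) <= C * Rabs t ^ n / INR (fact n)) ->
  forall t, Rabs (f t) <= C * Rabs t ^ (S n) / INR (fact (S n)).
Proof.
  assert (F : forall f df,
    f 0 = 0 -> (forall t, is_derive f t (df t)) ->
    (forall t, Rabs (df t) <= C * Rabs t ^ n / INR (fact n)) ->
    forall t, 0 <= t -> f t <= C * t ^ (S n) / INR (fact (S n))).
  { clear. intros f df H0 Hd Hb t Ht.
    assert (Hn := INR_fact_neq_0 n).
    assert (Hn' : INR (S n) <> 0) by (apply not_0_INR; lia).
    set (g := fun t => f t - C * t ^ (S n) / INR (fact (S n))).
    assert (G : g t <= g 0).
    { apply (derive_nonpos_decr g (fun t => df t - C * t ^ n / INR (fact n))); [easy| |].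
      - intros x _. unfold g. apply (is_derive_minus f); [easy|].
        auto_derive; [easy|].
        change (match n with 0%nat => 1 | S _ => INR n + 1 end) with (INR (S n)).
        change (fact n + n * fact n)%nat with (S n * fact n)%nat.
        rewrite mult_INR. rewrite Nat.pred_succ || simpl pred. field. split; easy.
      - intros x Hx. specialize (Hb x). rewrite (Rabs_right x) in Hb by lra.
        apply Rabs_le_between in Hb. lra. }
    unfold g in G. rewrite H0 in G.
    replace (0 ^ S n) with 0 in G by (simpl; ring). 
    unfold Rdiv in G. rewrite Rmult_0_r, Rmult_0_l in G. unfold Rdiv. lra. }
  assert (F2 : forall f df,
    f 0 = 0 -> (forall t, is_derive f t (df t)) ->
    (forall t, Rabs (df t) <= C * Rabs t ^ n / INR (fact n)) ->
    forall t, 0 <= t -> Rabs (f t) <= C * t ^ (S n) / INR (fact (S n))).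
  { clear f df. intros f df H0 Hd Hb t Ht. apply Rabs_le_between.
    split; [|apply (F f df H0 Hd Hb t Ht)].
    assert (H := F (fun t => - f t) (fun t => - df t)).
    cut (- f t <= C * t ^ S n / INR (fact (S n))); [lra|].
    apply H; [lra| | |easy].
    - intros x. now apply (is_derive_opp f).
    - intros x. now rewrite Rabs_Ropp. }
  intros H0 Hd Hb t. destruct (Rle_or_lt 0 t) as [L|L].
  - rewrite (Rabs_right t) by lra. now apply F2 with df.
  - rewrite (Rabs_left t) by lra.
    replace (f t) with (f (-1 * (-t) + 0)) by (f_equal; ring).
    apply (F2 (fun t => f (-1 * t + 0)) (fun t => -1 * df (-1 * t + 0))); [| | |lra].
    + now rewrite Rmult_0_r, Rplus_0_l.
    + intros x. now apply (is_derive_affine f df).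
    + intros x. rewrite Rabs_mult, Rabs_m1, Rmult_1_l.
      replace (Rabs x) with (Rabs (-1 * x + 0)); [easy|].
      rewrite Rplus_0_r, Rabs_mult, Rabs_m1. ring.
Qed.

(** One integration costs a factor 1 in the first component and [M] in the second; [M + 1] dominates
    both, so a single bound serves the two of them. *)
Lemma picard_bound (n : nat) (t : R) :
  Rabs (fst (picard n) t) <= (Rabs a + Rabs b) * (M + 1) ^ n * Rabs t ^ n / INR (fact n) /\
  Rabs (snd (picard n) t) <= (Rabs a + Rabs b) * (M + 1) ^ n * Rabs t ^ n / INR (fact n).
Proof.
  assert (HM0 : 0 <= M) by (eapply Rle_trans; [apply Rabs_pos|apply (HM 0)]).
  pose proof (Rabs_pos a) as Ha. pose proof (Rabs_pos b) as Hb.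
  revert t. induction n as [|n IH]; intros t.
  - simpl. lra.
  - assert (Hpos : forall x, 0 <= (Rabs a + Rabs b) * (M + 1) ^ n * Rabs x ^ n / INR (fact n)).
    { intros x. apply Rmult_le_pos.
      - apply Rmult_le_pos; [apply Rmult_le_pos|]; try apply pow_le; try lra. apply Rabs_pos.
      - apply Rlt_le, Rinv_0_lt_compat, INR_fact_lt_0. }
    split.
    + apply abs_le_of_derive with (snd (picard n)).
      * simpl. apply (RInt_point (V := R_CompleteNormedModule)).
      * intros x. exact (proj1 (picard_derive n x)).
      * intros x. destruct (IH x) as [_ H]. specialize (Hpos x). simpl. unfold Rdiv in *. nra.
    + apply abs_le_of_derive with (fun t => - q t * fst (picard n) t).
      * simpl. apply (RInt_point (V := R_CompleteNormedModule)).
      * intros x. exact (proj2 (picard_derive n x)).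
      * intros x. destruct (IH x) as [H _]. specialize (Hpos x). 
        rewrite Rabs_mult, Rabs_Ropp. specialize (HM x).
        pose proof (Rabs_pos (q x)). pose proof (Rabs_pos (fst (picard n) x)).
        simpl. unfold Rdiv in *. nra.
Qed.

(** Weierstrass test on the ball of radius [r], with the exponential series of [K * r] as
    majorant. *)
Lemma exp_bound_CVN (fn : nat -> R -> R) (B K : R) : 
  0 <= B -> 0 <= K ->
  (forall n t, Rabs (fn n t) <= B * K ^ n * Rabs t ^ n / INR (fact n)) -> CVN_R fn.
Proof.
  intros HB HK Hf r. unfold CVN_r.
  exists (fun n => B * (/ INR (fact n) * (K * r) ^ n)).
  exists (B * exp (K * r)). split.
  - apply Un_cv_ext with (fun n => B * sum_f_R0 (fun i => / INR (fact i) * (K * r) ^ i) n).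
    + intros n. rewrite scal_sum. apply sum_eq. intros i _.
      rewrite Rabs_right; [ring|].
      apply Rle_ge, Rmult_le_pos; [easy|]. apply Rmult_le_pos.
      * apply Rlt_le, Rinv_0_lt_compat, INR_fact_lt_0.
      * apply pow_le, Rmult_le_pos; [easy|]. destruct r; simpl; lra.
    + apply CV_mult.
      * intros e He. exists 0%nat. intros. unfold Rdist. now rewrite Rminus_diag, Rabs_R0.
      * unfold exp. destruct (exist_exp (K * r)) as [l Hl]. exact Hl.
  - intros n y Hy. unfold Boule in Hy. rewrite Rminus_0_r in Hy.
    eapply Rle_trans; [apply Hf|].
    rewrite Rpow_mult_distr. unfold Rdiv.
    assert (Rabs y ^ n <= r ^ n) by (apply pow_incr; split; [apply Rabs_pos|lra]).
    assert (0 <= B * K ^ n * / INR (fact n)).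
    { apply Rmult_le_pos; [apply Rmult_le_pos; [easy|now apply pow_le]|].
      apply Rlt_le, Rinv_0_lt_compat, INR_fact_lt_0. }
    nra.
Qed.

Lemma ex_sol : exists y z, sol q y z /\ y 0 = a /\ z 0 = b.
Proof.
  assert (HM0 : 0 <= M) by (eapply Rle_trans; [apply Rabs_pos|apply (HM 0)]).
  pose proof (Rabs_pos a) as Ha. pose proof (Rabs_pos b) as Hb.
  set (f := fun n => fst (picard n)). set (g := fun n => snd (picard n)).
  assert (Nf : CVN_R f).
  { apply exp_bound_CVN with (Rabs a + Rabs b) (M + 1); try lra. apply picard_bound. }
  assert (Ng : CVN_R g).
  { apply exp_bound_CVN with (Rabs a + Rabs b) (M + 1); try lra. apply picard_bound. }
  set (cf := CVN_R_CVS f Nf). set (cg := CVN_R_CVS g Ng).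
  set (y := SFL f cf). set (z := SFL g cg).
  (* Differentiation lowers the index by one: term 0 is constant and term [S k] of one component
     differentiates to term [k] of the other, so the partial sums that appear are off by one. *)
  assert (Df : forall n t, derivable_pt_lim (SP f (S n)) t (SP g n t)).
  { intros n t. apply is_derive_Reals. unfold SP. induction n as [|n IH].
    - simpl sum_f_R0. rewrite <- (Rplus_0_l (g 0%nat t)).
      apply (is_derive_plus (f 0%nat) (f 1%nat)).
      + apply (is_derive_const a).
      + exact (proj1 (picard_derive 0 t)).
    - apply (is_derive_plus (fun t => sum_f_R0 (fun k => f k t) (S n)) (f (S (S n)))).
      + exact IH.
      + exact (proj1 (picard_derive (S n) t)). }
  assert (Dg : forall n t, derivable_pt_lim (SP g (S n)) t (- q t * SP f n t)).
  { intros n t. apply is_derive_Reals. unfold SP. induction n as [|n IH].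
    - simpl sum_f_R0. rewrite <- (Rplus_0_l (- q t * f 0%nat t)).
      apply (is_derive_plus (g 0%nat) (g 1%nat)).
      + apply (is_derive_const b).
      + exact (proj2 (picard_derive 0 t)).
    - change (- q t * sum_f_R0 (fun k => f k t) (S n))
        with (- q t * (sum_f_R0 (fun k => f k t) n + f (S n) t)).
      rewrite Rmult_plus_distr_l.
      apply (is_derive_plus (fun t => sum_f_R0 (fun k => g k t) (S n)) (g (S (S n)))).
      + exact IH.
      + exact (proj2 (picard_derive (S n) t)). }
  assert (Uf : forall r : posreal, CVU (SP f) y 0 r) by (intros r; apply CVN_CVU, Nf).
  assert (Ug : forall r : posreal, CVU (SP g) z 0 r) by (intros r; apply CVN_CVU, Ng).
  assert (Cf : forall t, continuity_pt y t).
  { intros t. assert (Hr : 0 < Rabs t + 1) by (pose proof (Rabs_pos t); lra).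
    apply (CVU_continuity (fun n => SP f (S n)) y 0 (mkposreal _ Hr)).
    - intros e He. destruct (Uf (mkposreal _ Hr) e He) as [N HN].
      exists N. intros n s Hn. apply HN. lia.
    - intros n s _. eapply derivable_continuous_pt. exists (SP g n s). apply Df.
    - unfold Boule. simpl. rewrite Rminus_0_r. lra. }
  assert (Cg : forall t, continuity_pt z t).
  { intros t. assert (Hr : 0 < Rabs t + 1) by (pose proof (Rabs_pos t); lra).
    apply (CVU_continuity (fun n => SP g (S n)) z 0 (mkposreal _ Hr)).
    - intros e He. destruct (Ug (mkposreal _ Hr) e He) as [N HN].
      exists N. intros n s Hn. apply HN. lia.
    - intros n s _. eapply derivable_continuous_pt. eexists. apply Dg.
    - unfold Boule. simpl. rewrite Rminus_0_r. lra. }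
  assert (Pf : forall t, Un_cv (fun n => SP f (S n) t) (y t)).
  { intros t e He. assert (Hr : 0 < Rabs t + 1) by (pose proof (Rabs_pos t); lra).
    destruct (Uf (mkposreal _ Hr) e He) as [N HN]. exists N. intros n Hn.
    unfold Rdist. rewrite Rabs_minus_sym. apply HN; [lia|].
    unfold Boule. simpl. rewrite Rminus_0_r. lra. }
  assert (Pg : forall t, Un_cv (fun n => SP g (S n) t) (z t)).
  { intros t e He. assert (Hr : 0 < Rabs t + 1) by (pose proof (Rabs_pos t); lra).
    destruct (Ug (mkposreal _ Hr) e He) as [N HN]. exists N. intros n Hn.
    unfold Rdist. rewrite Rabs_minus_sym. apply HN; [lia|].
    unfold Boule. simpl. rewrite Rminus_0_r. lra. }
  (* All terms after the zeroth are integrals from 0 and vanish at 0, so every partial sum takes the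
     prescribed initial value there. *)
  assert (Z0 : forall h : nat -> R -> R, (forall n, h (S n) 0 = 0) -> forall n, SP h n 0 = h 0%nat 0).
  { intros h Hh n. unfold SP. induction n as [|n IH]; simpl; [easy|]. rewrite IH, Hh. ring. }
  exists y, z. split; [|split].
  - intros t. assert (Hr : 0 < Rabs t + 1) by (pose proof (Rabs_pos t); lra).
    assert (Bt : Boule 0 (mkposreal _ Hr) t).
    { unfold Boule. simpl. rewrite Rminus_0_r. lra. }
    split; apply is_derive_Reals.
    + apply (derivable_pt_lim_CVU (fun n => SP f (S n)) (SP g) y z t 0 (mkposreal _ Hr)); auto.
    + apply (derivable_pt_lim_CVU (fun n => SP g (S n)) (fun n t => - q t * SP f n t)
              z (fun t => - q t * y t) t 0 (mkposreal _ Hr)); auto.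
      * intros e He.
        destruct (Uf (mkposreal _ Hr) (e / (M + 1))) as [N HN]; [apply Rdiv_lt_0_compat; lra|].
        exists N. intros n s Hn Hs. specialize (HN n s Hn Hs).
        replace (- q s * y s - - q s * SP f n s) with (- (q s * (y s - SP f n s))) by ring.
        rewrite Rabs_Ropp, Rabs_mult. specialize (HM s).
        pose proof (Rabs_pos (q s)). pose proof (Rabs_pos (y s - SP f n s)).
        apply Rle_lt_trans with ((M + 1) * Rabs (y s - SP f n s)); [nra|].
        apply (Rmult_lt_compat_l (M + 1)) in HN; [|lra].
        replace ((M + 1) * (e / (M + 1))) with e in HN by (field; lra). lra.
      * intros s _. apply (continuity_pt_mult (fun t => - q t) y); [|apply Cf].
        apply (continuity_pt_opp q). apply continuity_pt_filterlim, Hq.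
  - apply (UL_sequence (fun n => SP f (S n) 0)); [apply Pf|].
    intros e He. exists 0%nat. intros n _. rewrite Z0.
    + unfold f, Rdist. simpl. now rewrite Rminus_diag, Rabs_R0.
    + intros k. apply (RInt_point (V := R_CompleteNormedModule)).
  - apply (UL_sequence (fun n => SP g (S n) 0)); [apply Pg|].
    intros e He. exists 0%nat. intros n _. rewrite Z0.
    + unfold g, Rdist. simpl. now rewrite Rminus_diag, Rabs_R0.
    + intros k. apply (RInt_point (V := R_CompleteNormedModule)).
Qed.

End Picard.

(** * Wronskians and Sturm separation *)

Lemma is_derive_wronskian (y z y2 v w w2 : R -> R) (t : R) :
  is_derive y t (z t) -> is_derive z t (y2 t) ->
  is_derive v t (w t) -> is_derive w t (w2 t) ->
  is_derive (fun t => y t * w t - z t * v t) t (y t * w2 t - y2 t * v t).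
Proof.
  intros Hy Hz Hv Hw. auto_derive.
  - repeat split; eexists; eassumption.
  - rewrite (Derive_eta y t _ Hy), (Derive_eta z t _ Hz), (Derive_eta v t _ Hv),
      (Derive_eta w t _ Hw). ring.
Qed.

Lemma wronskian_const (q y z v w : R -> R) :
  sol q y z -> sol q v w ->
  forall t t', y t * w t - z t * v t = y t' * w t' - z t' * v t'.
Proof.
  intros H1 H2. apply (derive_0_const (fun t => y t * w t - z t * v t)). intros t.
  destruct (H1 t), (H2 t).
  replace 0 with (y t * (- q t * v t) - (- q t * y t) * v t) by ring.
  now apply (is_derive_wronskian y z (fun t => - q t * y t) v w (fun t => - q t * v t)).
Qed.

Lemma is_derive_quotient (q y z v w : R -> R) (t : R) :
  sol q y z -> sol q v w -> v t <> 0 ->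
  is_derive (fun t => y t / v t) t (- (y t * w t - z t * v t) / v t ^ 2).
Proof.
  intros H1 H2 Hv. destruct (H1 t) as [Hy _], (H2 t) as [Hw _]. auto_derive.
  - repeat split; auto; eexists; eassumption.
  - rewrite (Derive_eta y t _ Hy), (Derive_eta v t _ Hw). field. easy.
Qed.

(** If [v] had no zero inside, the nonzero Wronskian would also keep it from vanishing at the
    endpoints. Then [y / v] is zero at both ends, while its derivative is minus the constant
    Wronskian over [v ^ 2], against the mean value theorem. *)
Lemma sturm_separation (q y z v w : R -> R) (x x' : R) :
  sol q y z -> sol q v w -> x < x' -> y x = 0 -> y x' = 0 ->
  y x * w x - z x * v x <> 0 ->
  exists t, x < t < x' /\ v t = 0.
Proof.
  intros H1 H2 Hx Y Y' HW.
  destruct (Rlt_or_le (v x * v x') 0) as [Hs | Hs].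
  { apply IVT_strict; auto. intros t _. now apply (sol_continuity q v w). }
  destruct (Classical_Prop.classic (exists t, x < t < x' /\ v t = 0)) as [|Hn]; [easy|exfalso].
  assert (HW' := wronskian_const q y z v w H1 H2 x).
  assert (Hv : forall t, x <= t <= x' -> v t <> 0).
  { intros t [[L | <- ] [L' | -> ]] E.
    - apply Hn. exists t. tauto.
    - rewrite (HW' x') in HW. rewrite Y', E in HW. apply HW. ring.
    - rewrite E, Y in HW. apply HW. ring.
    - lra. }
  destruct (MVT_is_derive (fun t => y t / v t) (fun t => - (y t * w t - z t * v t) / v t ^ 2) x x')
    as [t [Ht E]]; auto.
  - intros t Ht. apply (is_derive_quotient q); auto.
  - rewrite Y, Y' in E.
    assert (Hvt : v t <> 0) by (apply Hv; lra).
    rewrite <- (HW' t) in E.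
    apply HW. 
    assert (E0 : - (y x * w x - z x * v x) / v t ^ 2 * (x' - x) = 0) by (rewrite <- E; unfold Rdiv; ring).
    apply Rmult_integral in E0. destruct E0 as [E0|E0]; [|lra].
    assert (Hp : v t ^ 2 <> 0) by now apply pow_nonzero.
    apply (f_equal (fun r => r * v t ^ 2)) in E0.
    replace (- (y x * w x - z x * v x) / v t ^ 2 * v t ^ 2)
      with (- (y x * w x - z x * v x)) in E0 by (field; easy). lra.
Qed.

Lemma positive_start (f : R -> R) (l t : R) :
  0 < t -> is_derive f 0 l -> f 0 = 0 -> 0 < l -> exists h, 0 < h < t /\ 0 < f h.
Proof.
  intros Ht Hd F Hl. apply is_derive_Reals in Hd.
  destruct (Hd l Hl) as [d Hd'].
  set (h := Rmin d t / 2).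
  assert (Hh : 0 < h /\ h < d /\ h < t).
  { unfold h. pose proof (cond_pos d). pose proof (Rmin_l d t). pose proof (Rmin_r d t).
    assert (0 < Rmin d t) by (apply Rmin_pos; lra). lra. }
  exists h. split; [lra|]. specialize (Hd' h ltac:(lra)).
  rewrite Rabs_right in Hd' by lra. specialize (Hd' ltac:(lra)).
  rewrite Rplus_0_l, F, Rminus_0_r in Hd'. apply Rabs_def2 in Hd'.
  replace (f h) with (f h / h * h) by (field; lra). apply Rmult_lt_0_compat; lra.
Qed.

(** Near a zero [t] with nonzero slope, [f (t + h)] has the sign of [h * df t]. With slopes of equal
    sign, [f] therefore has opposite signs just after [x] and just before [x']. *)
Lemma zero_between (f df : R -> R) (x x' : R) :
  x < x' -> (forall t, is_derive f t (df t)) -> f x = 0 -> f x' = 0 ->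
  0 < df x * df x' -> exists t, x < t < x' /\ f t = 0.
Proof.
  intros Hx Hd Fx Fx' Hp.
  assert (Hloc : forall t, f t = 0 -> df t <> 0 -> exists d, 0 < d /\
     forall h, h <> 0 -> Rabs h < d -> 0 < f (t + h) * (h * df t)).
  { intros t Ft Hn. specialize (Hd t). apply is_derive_Reals in Hd.
    destruct (Hd (Rabs (df t))) as [d Hd']; [now apply Rabs_pos_lt|].
    exists d. split; [apply cond_pos|]. intros h Hh Hh'.
    specialize (Hd' h Hh Hh'). rewrite Ft, Rminus_0_r in Hd'.
    set (k := f (t + h) / h) in *.
    replace (f (t + h)) with (k * h) by (unfold k; field; easy).
    replace (k * h * (h * df t)) with (h ^ 2 * (k * df t)) by ring.
    apply Rmult_lt_0_compat; [now apply pow2_gt_0|].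
    unfold Rabs in Hd'. repeat destruct Rcase_abs; nra. }
  assert (df x <> 0) by (intros E; rewrite E in Hp; lra).
  assert (df x' <> 0) by (intros E; rewrite E in Hp; lra).
  destruct (Hloc x Fx H) as [d [Hd0 Hd1]].
  destruct (Hloc x' Fx' H0) as [d' [Hd0' Hd1']].
  set (h := Rmin (Rmin d d') (x' - x) / 3).
  assert (Hh : 0 < h /\ h < d /\ h < d' /\ 3 * h <= x' - x).
  { unfold h. pose proof (Rmin_l (Rmin d d') (x' - x)).
    pose proof (Rmin_r (Rmin d d') (x' - x)).
    pose proof (Rmin_l d d'). pose proof (Rmin_r d d').
    assert (0 < Rmin (Rmin d d') (x' - x)) by (repeat apply Rmin_pos; lra). lra. }
  specialize (Hd1 h). specialize (Hd1' (- h)).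
  rewrite Rabs_Ropp in Hd1'. rewrite Rabs_right in Hd1, Hd1' by lra.
  specialize (Hd1 ltac:(lra) ltac:(lra)). specialize (Hd1' ltac:(lra) ltac:(lra)).
  destruct (IVT_strict f (x + h) (x' + - h)) as [t [Ht Ht']].
  - lra.
  - intros t _. eapply is_derive_continuity_pt, Hd.
  - set (A := f (x + h)) in *. set (B := f (x' + - h)) in *.
    assert (0 < (A * (h * df x)) * (B * (- h * df x'))) by now apply Rmult_lt_0_compat.
    replace ((A * (h * df x)) * (B * (- h * df x'))) with (- (A * B) * (h ^ 2 * (df x * df x'))) in H1 by ring.
    assert (0 < h ^ 2 * (df x * df x')) by (apply Rmult_lt_0_compat; [apply pow_lt; lra|easy]).
    nra.
  - exists t. split; [lra|easy].
Qed.

(** * Periodic functions *)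

Lemma periodic_shift (f : R -> R) (p : R) (n : nat) :
  (forall t, f (t + p) = f t) -> forall t, f (t + INR n * p) = f t.
Proof.
  intros Hf. induction n as [|n IH]; intros t.
  - simpl. f_equal. ring.
  - rewrite S_INR. replace (t + (INR n + 1) * p) with ((t + INR n * p) + p) by ring.
    now rewrite Hf.
Qed.

Lemma periodic_reduce (f : R -> R) (p : R) :
  0 < p -> (forall t, f (t + p) = f t) ->
  forall t, exists r, 0 <= r <= p /\ f r = f t.
Proof.
  intros Hp Hf t.
  assert (Hpos : forall t, 0 <= t -> exists r, 0 <= r <= p /\ f r = f t).
  { clear t. intros t Ht.
    destruct (nfloor_ex (t / p)) as [n [Hn1 Hn2]].
    { apply Rmult_le_pos; [easy|]. now apply Rlt_le, Rinv_0_lt_compat. }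
    exists (t - INR n * p). 
    apply (Rmult_le_compat_r p) in Hn1; [|lra].
    apply (Rmult_lt_compat_r p) in Hn2; [|lra].
    replace (t / p * p) with t in Hn1, Hn2 by (field; lra).
    split; [lra|]. rewrite <- (periodic_shift f p n Hf). f_equal. ring. }
  destruct (Rle_or_lt 0 t) as [L|L]; [now apply Hpos|].
  destruct (nfloor_ex (- t / p)) as [n [Hn1 Hn2]].
  { apply Rmult_le_pos; [lra|]. now apply Rlt_le, Rinv_0_lt_compat. }
  destruct (Hpos (t + INR (S n) * p)) as [r [Hr E]].
  - rewrite S_INR. apply (Rmult_lt_compat_r p) in Hn2; [|lra].
    replace (- t / p * p) with (- t) in Hn2 by (field; lra). lra.
  - exists r. split; [easy|]. rewrite E. now apply periodic_shift.
Qed.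

(** * Hill's equation with an even potential symmetric about [a] *)

Section Hill.

Variables (q : R -> R) (M a : R) (c c1 s s1 : R -> R).
Hypothesis Ha : 0 < a.
Hypothesis HM : forall t, Rabs (q t) <= M.
Hypothesis Hpos : forall t, 0 < q t.
Hypothesis Heven : forall t, q (- t) = q t.
Hypothesis Hrefl : forall t, q (2 * a - t) = q t.
Hypothesis Hc : sol q c c1.
Hypothesis Hs : sol q s s1.
Hypothesis c_0 : c 0 = 1.
Hypothesis c1_0 : c1 0 = 0.
Hypothesis s_0 : s 0 = 0.
Hypothesis s1_0 : s1 0 = 1.

Lemma sol_eq (y z v w : R -> R) (t0 : R) :
  sol q y z -> sol q v w -> y t0 = v t0 -> z t0 = w t0 ->
  forall t, y t = v t /\ z t = w t.
Proof. now apply sol_unique with M. Qed.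

Lemma sol_basis (y z : R -> R) :
  sol q y z -> forall t, y t = y 0 * c t + z 0 * s t /\ z t = y 0 * c1 t + z 0 * s1 t.
Proof.
  intros H. apply (sol_eq y z (fun t => y 0 * c t + z 0 * s t)
    (fun t => y 0 * c1 t + z 0 * s1 t) 0 H).
  - now apply sol_lincomb.
  - rewrite c_0, s_0. ring.
  - rewrite c1_0, s1_0. ring.
Qed.

Lemma wronskian_basis (t : R) : c t * s1 t - c1 t * s t = 1.
Proof.
  rewrite (wronskian_const q c c1 s s1 Hc Hs t 0), c_0, c1_0, s1_0. ring.
Qed.

Lemma q_periodic (t : R) : q (t + 2 * a) = q t.
Proof.
  rewrite <- (Heven t), <- Hrefl. f_equal. ring.
Qed.

Lemma sol_neg (y z : R -> R) : sol q y z -> sol q (fun t => y (- t)) (fun t => - z (- t)).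
Proof.
  intros H. apply (sol_ext _ q _ _ _ _) with (4 := sol_affine q y z (-1) 0 H); intros t.
  - replace (-1 * t + 0) with (- t) by ring. rewrite Heven. ring.
  - f_equal. ring.
  - replace (-1 * t + 0) with (- t) by ring. ring.
Qed.

Lemma sol_refl (y z : R -> R) :
  sol q y z -> sol q (fun t => y (2 * a - t)) (fun t => - z (2 * a - t)).
Proof.
  intros H. apply (sol_ext _ q _ _ _ _) with (4 := sol_affine q y z (-1) (2 * a) H); intros t;
   replace (-1 * t + 2 * a) with (2 * a - t) by ring; rewrite ?Hrefl; ring.
Qed.

Lemma sol_shift (y z : R -> R) :
  sol q y z -> sol q (fun t => y (t + 2 * a)) (fun t => z (t + 2 * a)).
Proof.
  intros H. apply (sol_ext _ q _ _ _ _) with (4 := sol_affine q y z 1 (2 * a) H); intros t;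
   replace (1 * t + 2 * a) with (t + 2 * a) by ring; rewrite ?q_periodic; ring.
Qed.

Lemma sol_shift_neg (y z : R -> R) :
  sol q y z -> sol q (fun t => y (t - 2 * a)) (fun t => z (t - 2 * a)).
Proof.
  intros H. apply (sol_ext _ q _ _ _ _) with (4 := sol_affine q y z 1 (- (2 * a)) H); intros t;
   replace (1 * t + - (2 * a)) with (t - 2 * a) by ring; [|ring|ring].
  rewrite <- (q_periodic (t - 2 * a)).
  replace (t - 2 * a + 2 * a) with t by ring. ring.
Qed.

Lemma c_even (t : R) : c (- t) = c t /\ c1 (- t) = - c1 t.
Proof.
  destruct (sol_basis _ _ (sol_neg _ _ Hc) t) as [E1 E2].
  rewrite Ropp_0, c_0, c1_0 in E1, E2. lra.
Qed.

Lemma s_odd (t : R) : s (- t) = - s t /\ s1 (- t) = s1 t.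
Proof.
  destruct (sol_basis _ _ (sol_neg _ _ Hs) t) as [E1 E2].
  rewrite Ropp_0, s_0, s1_0 in E1, E2. lra.
Qed.

Definition half_trace : R := c a * s1 a + c1 a * s a.

Lemma half_trace_eq :
  half_trace = 2 * (c a * s1 a) - 1 /\ half_trace = 1 + 2 * (c1 a * s a).
Proof. unfold half_trace. pose proof (wronskian_basis a). lra. Qed.

(** The reflection of [c] about [a] is the solution with data [c (2 * a)] and [- c1 (2 * a)] at 0.
    Evaluating it and its derivative at [a] gives two linear equations; eliminating [c1 (2 * a)]
    with the Wronskian leaves [c (2 * a)]. The same is done for [s]. *)
Lemma monodromy_diag : c (2 * a) = half_trace /\ s1 (2 * a) = half_trace.
Proof.
  pose proof (wronskian_basis a) as W. unfold half_trace.
  destruct (sol_basis _ _ (sol_refl _ _ Hc) a) as [E1 E2].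
  destruct (sol_basis _ _ (sol_refl _ _ Hs) a) as [F1 F2].
  rewrite Rminus_0_r in E1, E2, F1, F2.
  replace (2 * a - a) with a in E1, E2, F1, F2 by ring. split.
  - rewrite <- (Rmult_1_r (c (2 * a))), <- W.
    apply (f_equal (fun r => r * s1 a)) in E1. apply (f_equal (fun r => r * s a)) in E2. lra.
  - rewrite <- (Rmult_1_r (s1 (2 * a))), <- W.
    apply (f_equal (fun r => r * c1 a)) in F1. apply (f_equal (fun r => r * c a)) in F2. lra.
Qed.

(** The analogue of the double angle formula for the sine, from expanding the translate of [s] by
    [2 * a] in the basis and evaluating at [a]. *)
Lemma s_double : s (2 * a) = 2 * s a * s1 a.
Proof.
  destruct (sol_basis _ _ (sol_shift_neg _ _ Hs) a) as [E1 E2].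
  destruct (sol_basis _ _ (sol_shift_neg _ _ Hs) (2 * a)) as [F1 F2].
  rewrite Rminus_0_l in E1, E2, F1, F2.
  replace (a - 2 * a) with (- a) in E1, E2 by ring.
  destruct (s_odd a) as [O1 O2], (s_odd (2 * a)) as [O3 O4].
  destruct monodromy_diag as [Dc Ds].
  rewrite O1 in E1. rewrite O3, O4, Ds in E1.
  rewrite O2, O3, O4, Ds in E2.
  pose proof (wronskian_basis a) as W.
  replace (s (2 * a)) with (s (2 * a) * (c a * s1 a - c1 a * s a)) by (rewrite W; ring).
  apply (f_equal (fun r => r * s1 a)) in E1. apply (f_equal (fun r => r * s a)) in E2.
  lra.
Qed.

(** Cayley-Hamilton for the monodromy matrix [P]: determinant 1 and trace [2 * half_trace] give
    [P + P^-1 = 2 * half_trace]. *)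
Lemma translation_recurrence (y z : R -> R) :
  sol q y z -> forall t, y (t + 2 * a) + y (t - 2 * a) = 2 * half_trace * y t.
Proof.
  intros H t.
  assert (H' := sol_lincomb _ _ _ _ _ 1 1 (sol_shift _ _ H) (sol_shift_neg _ _ H)).
  assert (H2 := sol_lincomb _ _ _ _ _ (2 * half_trace) 0 H H).
  destruct (sol_eq _ _ _ _ 0 H' H2) with (t := t) as [E _].
  - rewrite Rplus_0_l, Rminus_0_l.
    destruct (sol_basis _ _ H (2 * a)) as [E1 _], (sol_basis _ _ H (- (2 * a))) as [E2 _].
    destruct (s_odd (2 * a)) as [O _], (c_even (2 * a)) as [O' _].
    rewrite E1, E2, O, O'. rewrite (proj1 monodromy_diag). ring.
  - rewrite Rplus_0_l, Rminus_0_l.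
    destruct (sol_basis _ _ H (2 * a)) as [_ E1], (sol_basis _ _ H (- (2 * a))) as [_ E2].
    destruct (s_odd (2 * a)) as [_ O], (c_even (2 * a)) as [_ O'].
    rewrite E1, E2, O, O'. rewrite (proj2 monodromy_diag). ring.
  - lra.
Qed.

(** The recurrence makes the quadratic form [I] in [y t] and [y (t + 2 * a)] periodic in [t]. For
    [D ^ 2 < 1] it is positive definite and at least [(1 - D ^ 2) * y t ^ 2], so its maximum over
    one period bounds [y]. *)
Lemma bounded_of_half_trace (y z : R -> R) :
  sol q y z -> Rabs half_trace < 1 -> exists B, forall t, Rabs (y t) <= B.
Proof.
  intros H HD. apply Rabs_def2 in HD.
  set (D := half_trace) in *.
  assert (HD2 : 0 < 1 - D ^ 2) by nra.
  set (I := fun t => y t ^ 2 - 2 * D * y t * y (t + 2 * a) + y (t + 2 * a) ^ 2).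
  assert (HI : forall t, I (t + 2 * a) = I t).
  { intros t. unfold I. pose proof (translation_recurrence y z H (t + 2 * a)) as R.
    replace (t + 2 * a - 2 * a) with t in R by ring.
    fold D in R. replace (y (t + 2 * a + 2 * a)) with (2 * D * y (t + 2 * a) - y t) by lra. ring. }
  assert (Cy : forall t, continuity_pt (fun t => y (t + 2 * a)) t).
  { intros t. apply (sol_continuity q _ _ t (sol_shift _ _ H)). }
  assert (Cy' : forall t, continuity_pt y t).
  { intros t. apply (sol_continuity q _ _ t H). }
  assert (CI : forall t, continuity_pt I t).
  { intros t. unfold I.
    apply (continuity_pt_plus (fun t => y t ^ 2 - 2 * D * y t * y (t + 2 * a)) (fun t => y (t + 2 * a) ^ 2)).
    - apply (continuity_pt_minus (fun t => y t ^ 2) (fun t => 2 * D * y t * y (t + 2 * a))).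
      + apply (continuity_pt_comp y (fun x => x ^ 2)); [easy|]. apply derivable_continuous_pt, derivable_pt_pow.
      + apply (continuity_pt_mult (fun t => 2 * D * y t) (fun t => y (t + 2 * a))); [|easy].
        now apply (continuity_pt_scal y).
    - apply (continuity_pt_comp (fun t => y (t + 2 * a)) (fun x => x ^ 2)); [easy|].
      apply derivable_continuous_pt, derivable_pt_pow. }
  destruct (continuity_ab_maj I 0 (2 * a)) as [m [Hm _]]; [lra|intros; apply CI|].
  (* The quotient bounds [y t ^ 2]; adding 1 turns it into a bound for [Rabs (y t)] without a square
     root. *)
  exists (I m / (1 - D ^ 2) + 1). intros t.
  destruct (periodic_reduce I (2 * a) ltac:(lra) HI t) as [r [Hr E]].
  specialize (Hm r Hr). rewrite E in Hm.
  assert (HIt : y t ^ 2 * (1 - D ^ 2) <= I t).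
  { unfold I. pose proof (pow2_ge_0 (y (t + 2 * a) - D * y t)). nra. }
  assert (HB : y t ^ 2 <= I m / (1 - D ^ 2)).
  { apply (Rmult_le_reg_r (1 - D ^ 2)); [easy|].
    replace (I m / (1 - D ^ 2) * (1 - D ^ 2)) with (I m) by (field; lra). lra. }
  rewrite <- (pow2_abs (y t)) in HB. pose proof (Rabs_pos (y t)). 
  destruct (Rle_or_lt (Rabs (y t)) 1); nra.
Qed.

Lemma s_pos_left : (forall t, 0 <= t <= a -> 0 < s1 t) -> forall t, 0 < t <= a -> 0 < s t.
Proof.
  intros H t Ht. rewrite <- s_0. apply (derive_pos_incr s s1); [lra| |].
  - intros x _. apply Hs.
  - intros x Hx. apply H. lra.
Qed.

Lemma s_pos (H : forall t, 0 <= t <= a -> 0 < s1 t) :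
  forall t, 0 < t <= 2 * a -> 0 < s t.
Proof.
  intros t Ht. destruct (Rle_or_lt t a) as [L|L]; [now apply s_pos_left|].
  pose proof (H a ltac:(lra)) as Ha1. pose proof (s_pos_left H a ltac:(lra)) as Ha0.
  destruct (Req_dec t (2 * a)) as [->|N]; [rewrite s_double; nra|].
  (* The quotient of [s] by its reflection about [a] increases from the value 1 at [a]. *)
  set (g := fun t => s (2 * a - t)). set (g1 := fun t => - s1 (2 * a - t)).
  assert (Hg : sol q g g1) by now apply sol_refl.
  assert (Gp : forall x, a <= x <= t -> 0 < g x) by (intros x Hx; apply s_pos_left; auto; lra).
  assert (Ga : g a = s a /\ g1 a = - s1 a).
  { unfold g, g1. replace (2 * a - a) with a by ring. easy. }
  assert (HQ : s a / g a < s t / g t).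
  { apply (derive_pos_incr (fun t => s t / g t) (fun t => - (s t * g1 t - s1 t * g t) / g t ^ 2)); [easy| |].
    - intros x Hx. apply (is_derive_quotient q); auto. specialize (Gp x Hx). lra.
    - intros x Hx. rewrite (wronskian_const q s s1 g g1 Hs Hg x a).
      destruct Ga as [-> ->]. apply Rdiv_lt_0_compat; [nra|].
      apply pow_lt, Gp. lra. }
  rewrite (proj1 Ga) in HQ. unfold Rdiv in HQ at 1. rewrite Rinv_r in HQ by lra.
  specialize (Gp t ltac:(lra)).
  apply (Rmult_lt_compat_r (g t)) in HQ; [|easy].
  replace (s t / g t * g t) with (s t) in HQ by (field; lra). lra.
Qed.

Lemma c_decr (t : R) : 0 < t -> (forall r, 0 <= r < t -> 0 < c r) -> c1 t < 0.
Proof.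
  intros Ht H. rewrite <- c1_0. apply (derive_neg_decr c1 (fun t => - q t * c t)); [easy| |].
  - intros x _. apply Hc.
  - intros x Hx. specialize (H x ltac:(lra)). specialize (Hpos x). nra.
Qed.

(** Positivity of [c a * s1 a] gives [half_trace > -1] through the first form of [half_trace_eq];
    [c1 a < 0 < s a] gives [half_trace < 1] through the second. *)
Lemma half_trace_stable :
  (forall t, 0 <= t <= a -> 0 < c t) -> (forall t, 0 <= t <= a -> 0 < s1 t) ->
  Rabs half_trace < 1.
Proof.
  intros H1 H2.
  destruct half_trace_eq as [E1 E2].
  pose proof (H1 a ltac:(lra)). pose proof (H2 a ltac:(lra)).
  pose proof (s_pos_left H2 a ltac:(lra)).
  assert (c1 a < 0) by (apply c_decr; auto; intros; apply H1; lra).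
  apply Rabs_def1; nra.
Qed.

(** By the Wronskian, [c / s] has derivative [- 1 / s ^ 2], so after a zero it is negative. *)
Lemma c_neg_after_zero (x : R) :
  (forall t, 0 < t <= a -> 0 < s t) -> 0 < x < a -> c x = 0 -> c a < 0.
Proof.
  intros H Hx Cx.
  assert (HQ : c a / s a < c x / s x).
  { apply (derive_neg_decr (fun t => c t / s t) (fun t => - (c t * s1 t - c1 t * s t) / s t ^ 2)); [easy| |].
    - intros t Ht. apply (is_derive_quotient q); auto. specialize (H t ltac:(lra)). lra.
    - intros t Ht. rewrite wronskian_basis.
      assert (0 < 1 / s t ^ 2) by (apply Rdiv_lt_0_compat; [lra|apply pow_lt, H; lra]).
      unfold Rdiv in *. lra. }
  rewrite Cx in HQ. specialize (H a ltac:(lra)).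
  apply (Rmult_lt_compat_r (s a)) in HQ; [|easy].
  replace (c a / s a * s a) with (c a) in HQ by (field; lra). unfold Rdiv in HQ. lra.
Qed.

Lemma nontrivial_zero_derivative (y z : R -> R) (t0 : R) :
  sol q y z -> (exists t, y t <> 0) -> y t0 = 0 -> z t0 <> 0.
Proof.
  intros H [t Ht] Hy Hz. apply Ht. now apply (sol_zero q y z M t0).
Qed.

Lemma floquet_equation (y z : R -> R) (mu : R) :
  sol q y z -> (exists t, y t <> 0) -> (forall t, y (t + 2 * a) = mu * y t) ->
  mu ^ 2 + 1 = 2 * half_trace * mu.
Proof.
  intros H [t Ht] Hmu. pose proof (translation_recurrence y z H (t + 2 * a)) as R.
  replace (t + 2 * a - 2 * a) with t in R by ring. rewrite !Hmu in R.
  apply Rmult_eq_reg_r with (y t); [|easy]. lra.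
Qed.

(** Here [mu < 0], so [y] changes sign over a period and has a zero. Two zeros in [[0, 2 * a)] would
    enclose a zero of [s] or, if the first is 0, make [y] a multiple of [s]; both contradict [s > 0]
    on [(0, 2 * a]]. *)
Lemma tongue_unique_zero (y z : R -> R) (mu : R) :
  (forall t, 0 <= t <= a -> 0 < s1 t) -> half_trace < -1 ->
  sol q y z -> (exists t, y t <> 0) -> (forall t, y (t + 2 * a) = mu * y t) ->
  exists x, 0 <= x < 2 * a /\ y x = 0 /\ forall t, 0 <= t < 2 * a -> y t = 0 -> t = x.
Proof.
  intros Hs1 HD H Hn Hmu.
  assert (Hp := s_pos Hs1).
  assert (E := floquet_equation y z mu H Hn Hmu).
  assert (Hneg : mu < 0) by nra.
  assert (Hno : forall x x', 0 <= x -> x < x' -> x' < 2 * a -> y x = 0 -> y x' = 0 -> False).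
  { intros x x' H0 H1 H2 Y Y'.
    assert (Hz := nontrivial_zero_derivative y z x H Hn Y).
    destruct (Req_dec x 0) as [->|].
    - destruct (sol_basis y z H x') as [F _]. rewrite Y, Y' in F.
      specialize (Hp x' ltac:(lra)). apply Hz. nra.
    - destruct (sturm_separation q y z s s1 x x') as [t [Ht St]]; auto.
      + rewrite Y. specialize (Hp x ltac:(lra)). intros F. apply Hz. nra.
      + specialize (Hp t ltac:(lra)). lra. }
  assert (Hex : exists x, 0 <= x < 2 * a /\ y x = 0).
  { destruct (Req_dec (y 0) 0) as [Y|Y]; [exists 0; split; [lra|easy]|].
    destruct (IVT_strict y 0 (2 * a)) as [x [Hx Yx]]; [lra| | |].
    - intros. now apply (sol_continuity q y z).
    - pose proof (Hmu 0) as F. rewrite Rplus_0_l in F. rewrite F.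
      assert (0 < y 0 ^ 2) by now apply pow2_gt_0. nra.
    - exists x. split; [lra|easy]. }
  destruct Hex as [x [Hx Yx]]. exists x. split; [easy|]. split; [easy|].
  intros t Ht Yt. destruct (Rtotal_order t x) as [L|[L|L]]; [|easy|]; exfalso.
  - apply (Hno t x); auto; lra.
  - apply (Hno x t); auto; lra.
Qed.

(** The vector [(s (2 * a), mu - half_trace)] is an eigenvector of the monodromy matrix. Were
    [s (2 * a)] zero, the determinant would equal [half_trace ^ 2], which is not 1. *)
Lemma ex_floquet :
  1 < Rabs half_trace ->
  exists mu, mu ^ 2 + 1 = 2 * half_trace * mu /\
    s (2 * a) <> 0 /\
    forall t, let y := fun t => s (2 * a) * c t + (mu - half_trace) * s t in
      y (t + 2 * a) = mu * y t.
Proof.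
  intros HD. set (D := half_trace) in *.
  assert (HD2 : 0 < D ^ 2 - 1).
  { rewrite <- pow2_abs. nra. }
  set (mu := D + sqrt (D ^ 2 - 1)).
  assert (E : mu ^ 2 + 1 = 2 * D * mu).
  { pose proof (sqrt_sqrt (D ^ 2 - 1) ltac:(lra)). unfold mu. nra. }
  destruct monodromy_diag as [Dc Ds]. fold D in Dc, Ds.
  pose proof (wronskian_basis (2 * a)) as W. rewrite Dc, Ds in W.
  exists mu. split; [easy|]. split.
  - intros Z. rewrite Z in W. nra.
  - intros t y.
    assert (Hy : sol q y (fun t => s (2 * a) * c1 t + (mu - D) * s1 t)) by now apply sol_lincomb.
    assert (H1 := sol_shift _ _ Hy).
    assert (H2 := sol_lincomb _ _ _ _ _ mu 0 Hy Hy).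
    destruct (sol_eq _ _ _ _ 0 H1 H2) with (t := t) as [F _].
    + unfold y. rewrite Rplus_0_l, Dc, c_0, s_0. ring.
    + rewrite Rplus_0_l, Ds, c1_0, s1_0. nra.
    + rewrite F. ring.
Qed.

(** A single zero of the Floquet solution [y] modulo [2 * a] is refuted. It would leave [s] without
    zeros on [(0, a]], which makes [s1] decrease to a negative [s1 a], hence [half_trace > 1] and
    [mu > 0]; but a solution with a positive multiplier cannot have exactly one sign change per
    period. A solution without zeros satisfies the conclusion vacuously, so no zeros need be
    counted. *)
Lemma beyond_tongue (x1 t0 : R) :
  0 < x1 < a -> c x1 = 0 -> 0 < t0 < a -> s1 t0 < 0 -> 1 < Rabs half_trace ->
  exists mu y z, sol q y z /\ s (2 * a) <> 0 /\
    mu ^ 2 + 1 = 2 * half_trace * mu /\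
    (exists t, y t <> 0) /\ (forall t, y (t + 2 * a) = mu * y t) /\
    forall x, 0 <= x < 2 * a -> y x = 0 ->
      exists x', 0 <= x' < 2 * a /\ y x' = 0 /\ x' <> x.
Proof.
  intros Hx1 Cx1 Ht0 St0 HD.
  destruct (ex_floquet HD) as [mu [E [Hsn Hmu]]].
  set (y := fun t => s (2 * a) * c t + (mu - half_trace) * s t) in *.
  set (z := fun t => s (2 * a) * c1 t + (mu - half_trace) * s1 t).
  assert (H : sol q y z) by now apply sol_lincomb.
  assert (Y0 : y 0 = s (2 * a)) by (unfold y; rewrite c_0, s_0; ring).
  assert (Hn : exists t, y t <> 0) by (exists 0; now rewrite Y0).
  exists mu, y, z. split; [easy|]. split; [easy|].
  split; [easy|]. split; [easy|]. split; [easy|].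
  intros x Hx Yx.
  destruct (Classical_Prop.classic (exists x', 0 <= x' < 2 * a /\ y x' = 0 /\ x' <> x)) as [|Hun]; [easy|exfalso].
  assert (Huniq : forall t, 0 <= t < 2 * a -> y t = 0 -> t = x).
  { intros t Ht Yt. destruct (Req_dec t x) as [|N]; [easy|]. exfalso. apply Hun. now exists t. }
  assert (Hs0 : forall t, 0 < t <= a -> s t <> 0).
  { intros t Ht St.
    (* The zeros [-t, 0, t] of [s] enclose two zeros of [y] that are distinct modulo [2 * a]. *)
    assert (HW : forall r, s r * z r - s1 r * y r <> 0).
    { intros r. rewrite (wronskian_const q s s1 y z Hs H r 0), s_0, s1_0, Y0. lra. }
    destruct (s_odd t) as [O _].
    destruct (sturm_separation q s s1 y z 0 t) as [p [Hp Yp]]; auto; try lra.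
    destruct (sturm_separation q s s1 y z (- t) 0) as [r [Hr Yr]]; auto; try lra.
    assert (p = x) by (apply Huniq; auto; lra).
    assert (r + 2 * a = x); [|lra]. apply Huniq; [lra|].
    change (y (r + 2 * a) = 0). rewrite Hmu. fold (y r). rewrite Yr. ring. }
  assert (Hsp : forall t, 0 < t <= a -> 0 < s t).
  { intros t Ht. destruct (Rlt_or_le 0 (s t)) as [|L]; [easy|exfalso].
    destruct (positive_start s 1 t) as [h [Hh Sh]]; [lra| |easy|lra|].
    { rewrite <- s1_0. apply Hs. }
    destruct (first_zero s h t) as [p [Hp [Sp _]]]; auto; try lra.
    { intros. now apply (sol_continuity q s s1). }
    apply (Hs0 p); auto; lra. }
  assert (Hs1a : s1 a < 0).
  { apply Rlt_trans with (s1 t0); [|easy].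
    apply (derive_neg_decr s1 (fun t => - q t * s t)); [lra| |].
    - intros t _. apply Hs.
    - intros t Ht. specialize (Hsp t ltac:(lra)). specialize (Hpos t). nra. }
  assert (Hca : c a < 0) by now apply c_neg_after_zero with x1.
  destruct half_trace_eq as [E1 _].
  (* Both [c a] and [s1 a] are negative, so [half_trace > -1], and [1 < Rabs half_trace] leaves only
     the branch above 1. *)
  assert (HD1 : 1 < half_trace).
  { assert (-1 < half_trace) by nra. unfold Rabs in HD. destruct Rcase_abs; lra. }
  assert (Hmup : 0 < mu) by nra.
  assert (Hz := nontrivial_zero_derivative y z x H Hn Yx).
  (* The derivative has the same multiplier. As [mu > 0], the slopes of [y] at the zeros [x] and
     [x + 2 * a] have equal sign, which forces another zero in between. *)
  assert (Zmu : z (x + 2 * a) = mu * z x).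
  { assert (H2 := sol_lincomb _ _ _ _ _ mu 0 H H).
    assert (F1 := proj1 (sol_shift _ _ H x)). assert (F2 := proj1 (H2 x)).
    rewrite <- (is_derive_unique _ _ _ F1).
    rewrite (Derive_ext _ (fun t => mu * y t + 0 * y t)).
    - rewrite (is_derive_unique _ _ _ F2). ring.
    - intros t. rewrite (Hmu t). unfold y. ring. }
  destruct (zero_between y z x (x + 2 * a)) as [p [Hp Yp]]; auto; try lra.
  - intros t. apply H.
  - change (y (x + 2 * a) = 0). rewrite Hmu. fold (y x). rewrite Yx. ring.
  - rewrite Zmu. assert (0 < z x ^ 2) by now apply pow2_gt_0. nra.
  - destruct (Rlt_or_le p (2 * a)) as [L|L].
    + assert (p = x) by (apply Huniq; auto; lra). lra.
    + assert (p - 2 * a = x); [|lra]. apply Huniq; [lra|].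
      pose proof (Hmu (p - 2 * a)) as F. cbv zeta in F.
      change (y (p - 2 * a + 2 * a) = mu * y (p - 2 * a)) in F.
      replace (p - 2 * a + 2 * a) with p in F by ring. rewrite Yp in F.
      symmetry in F. apply Rmult_integral in F. destruct F; [lra|easy].
Qed.

End Hill.

(** * The Duffing equation *)

Definition duffing (u v : R -> R) : Prop :=
  forall t, is_derive u t (v t) /\ is_derive v t (- (u t + u t ^ 3)).

Definition energy (d : R) : R := d ^ 2 + d ^ 4 / 2.

Lemma duffing_energy (u v : R -> R) :
  duffing u v -> forall t t',
  v t ^ 2 + u t ^ 2 + u t ^ 4 / 2 = v t' ^ 2 + u t' ^ 2 + u t' ^ 4 / 2.
Proof.
  intros H. apply (derive_0_const (fun t => v t ^ 2 + u t ^ 2 + u t ^ 4 / 2)).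
  intros t. destruct (H t) as [Hu Hv]. auto_derive.
  - repeat split; eexists; eassumption.
  - rewrite (Derive_eta u t _ Hu), (Derive_eta v t _ Hv). field.
Qed.

Lemma duffing_bounded (u v : R -> R) :
  duffing u v -> exists B, 0 <= B /\ forall t, Rabs (u t) <= B.
Proof.
  intros H. set (E := v 0 ^ 2 + u 0 ^ 2 + u 0 ^ 4 / 2).
  pose proof (pow2_ge_0 (v 0)). pose proof (pow2_ge_0 (u 0)). pose proof (pow2_ge_0 (u 0 ^ 2)).
  assert (0 <= E) by (unfold E; nra).
  exists (E + 1). split; [lra|]. intros t.
  pose proof (duffing_energy u v H t 0) as HE. fold E in HE.
  pose proof (pow2_ge_0 (v t)). pose proof (pow2_ge_0 (u t ^ 2)).
  rewrite <- (pow2_abs (u t)) in HE. pose proof (Rabs_pos (u t)).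
  destruct (Rle_or_lt (Rabs (u t)) 1); nra.
Qed.

(** Since [x ^ 3 - y ^ 3 = (x - y) * (x ^ 2 + x * y + y ^ 2)], the difference of two orbits solves a
    linear equation with bounded potential; the linear theory thereby gives uniqueness and
    continuous dependence for the nonlinear equation. *)
Lemma duffing_diff (u v u' v' : R -> R) :
  duffing u v -> duffing u' v' ->
  sol (fun t => 1 + u t ^ 2 + u t * u' t + u' t ^ 2)
      (fun t => u t - u' t) (fun t => v t - v' t).
Proof.
  intros H H' t. destruct (H t), (H' t). split.
  - now apply (is_derive_minus u u').
  - replace (- (1 + u t ^ 2 + u t * u' t + u' t ^ 2) * (u t - u' t))
      with (- (u t + u t ^ 3) - - (u' t + u' t ^ 3)) by ring.
    now apply (is_derive_minus v v').
Qed.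

Lemma duffing_diff_bound (x y B : R) :
  Rabs x <= B -> Rabs y <= B -> Rabs (1 + x ^ 2 + x * y + y ^ 2) <= 1 + 3 * B ^ 2.
Proof.
  intros Hx Hy. apply Rabs_le_between in Hx, Hy. apply Rabs_le. nra.
Qed.

Lemma duffing_unique (u v u' v' : R -> R) (t0 : R) :
  duffing u v -> duffing u' v' -> u t0 = u' t0 -> v t0 = v' t0 ->
  forall t, u t = u' t /\ v t = v' t.
Proof.
  intros H H' E1 E2 t.
  destruct (duffing_bounded u v H) as [B [HB0 HB]].
  destruct (duffing_bounded u' v' H') as [B' [HB0' HB']].
  destruct (sol_zero (fun t => 1 + u t ^ 2 + u t * u' t + u' t ^ 2)
    (fun t => u t - u' t) (fun t => v t - v' t) (1 + 3 * (B + B') ^ 2) t0) with (t := t); try lra.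
  - intros r. specialize (HB r). specialize (HB' r). apply duffing_diff_bound; lra.
  - now apply duffing_diff.
Qed.

Lemma duffing_affine (u v : R -> R) (e a b : R) :
  e ^ 2 = 1 -> a ^ 2 = 1 -> duffing u v ->
  duffing (fun t => e * u (a * t + b)) (fun t => e * (a * v (a * t + b))).
Proof.
  intros He Ha H t. destruct (H (a * t + b)) as [Hu Hv]. split.
  - apply (is_derive_scal (fun t => u (a * t + b))). now apply (is_derive_affine u v).
  - replace (- (e * u (a * t + b) + (e * u (a * t + b)) ^ 3))
      with (e * (a * (a * - (u (a * t + b) + u (a * t + b) ^ 3)))).
    + apply (is_derive_scal (fun t => a * v (a * t + b))).
      apply (is_derive_scal (fun t => v (a * t + b))).
      now apply (is_derive_affine v (fun t => - (u t + u t ^ 3))).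
    + transitivity (- (a ^ 2) * (e * u (a * t + b) + (1 * e) * u (a * t + b) ^ 3)); [ring|].
      rewrite <- He at 1. rewrite Ha. ring.
Qed.

Lemma duffing_continuity (u v : R -> R) (t : R) :
  duffing u v -> continuity_pt u t /\ continuity_pt v t.
Proof.
  intros H. destruct (H t). split; eapply is_derive_continuity_pt; eauto.
Qed.

Definition quarter_period (u : R -> R) (A : R) : Prop :=
  0 < A /\ u A = 0 /\ forall t, 0 <= t < A -> 0 < u t.

Lemma quarter_period_unique (u : R -> R) (A A' : R) :
  quarter_period u A -> quarter_period u A' -> A = A'.
Proof.
  intros [H1 [H2 H3]] [K1 [K2 K3]].
  destruct (Rtotal_order A A') as [L|[L|L]]; [exfalso|easy|exfalso].
  - specialize (K3 A). lra.
  - specialize (H3 A'). lra.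
Qed.

Section Duffing.

Variables (d : R) (u v : R -> R).
Hypothesis Hd : 0 < d.
Hypothesis Hu : duffing u v.
Hypothesis u_0 : u 0 = d.
Hypothesis v_0 : v 0 = 0.

Lemma duffing_velocity (t : R) : v t ^ 2 = energy d - u t ^ 2 - u t ^ 4 / 2.
Proof.
  pose proof (duffing_energy u v Hu t 0) as E. rewrite u_0, v_0 in E. unfold energy. lra.
Qed.

Lemma duffing_abs_le (t : R) : Rabs (u t) <= d.
Proof.
  pose proof (duffing_velocity t) as E. unfold energy in E.
  pose proof (pow2_ge_0 (v t)). pose proof (pow2_ge_0 (u t)). pose proof (pow2_ge_0 d).
  assert (u t ^ 2 <= d ^ 2) by nra.
  rewrite <- (Rabs_pos_eq d) by lra. apply Rsqr_le_abs_0. unfold Rsqr. lra.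
Qed.

Lemma v_neg_start (t : R) : 0 < t -> (forall r, 0 <= r < t -> 0 < u r) -> v t < 0.
Proof.
  intros Ht H. rewrite <- v_0.
  apply (derive_neg_decr v (fun t => - (u t + u t ^ 3))); [easy| |].
  - intros x _. apply Hu.
  - intros x Hx. specialize (H x ltac:(lra)). pose proof (pow_lt (u x) 3 H). lra.
Qed.

(** If [u] stayed positive, [v] would keep decreasing and remain below [v 1 < 0] after time 1.
    Starting from at most [d], [u] would then reach 0 by the time [T]. *)
Lemma ex_quarter_period : exists A, quarter_period u A.
Proof.
  assert (Hex : exists t, 0 <= t /\ u t <= 0).
  { destruct (Classical_Prop.classic (exists t, 0 <= t /\ u t <= 0)) as [|Hn]; [easy|exfalso].
    assert (Hp : forall t, 0 <= t -> 0 < u t).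
    { intros t Ht. destruct (Rlt_or_le 0 (u t)); [easy|]. exfalso. apply Hn. now exists t. }
    assert (V1 : v 1 < 0) by (apply v_neg_start; [lra|]; intros; apply Hp; lra).
    set (T := 1 + d / - v 1).
    assert (HT : 0 < d / - v 1) by (apply Rdiv_lt_0_compat; lra).
    destruct (MVT_is_derive u v 1 T) as [x [Hx E]]; [unfold T; lra|intros; apply Hu|].
    assert (Vx : v x < v 1).
    { apply (derive_neg_decr v (fun t => - (u t + u t ^ 3))); [lra|intros; apply Hu|].
      intros r Hr. specialize (Hp r ltac:(lra)). pose proof (pow_lt (u r) 3 Hp). lra. }
    assert (HT' : - v 1 * (T - 1) = d) by (unfold T; field; lra).
    pose proof (Hp T ltac:(unfold T; lra)).
    pose proof (duffing_abs_le 1) as U1. apply Rabs_le_between in U1.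
    assert (0 < T - 1) by (unfold T; lra). nra. }
  destruct Hex as [t [Ht Ut]].
  destruct (first_zero u 0 t) as [A [HA [UA HA']]]; auto.
  - intros. now apply (duffing_continuity u v).
  - lra.
  - exists A. split; [lra|]. now split.
Qed.

Variable A : R.
Hypothesis HA : quarter_period u A.

Lemma u_even (t : R) : u (- t) = u t /\ v (- t) = - v t.
Proof.
  destruct (duffing_unique _ _ _ _ 0 (duffing_affine u v 1 (-1) 0 ltac:(ring) ltac:(ring) Hu) Hu) with (t := t)
    as [E1 E2].
  - rewrite Rmult_0_r, Rplus_0_l. ring.
  - rewrite Rmult_0_r, Rplus_0_l, v_0. ring.
  - replace (-1 * t + 0) with (- t) in E1, E2 by ring. lra.
Qed.

Lemma u_odd_about_quarter (t : R) : u (2 * A - t) = - u t /\ v (2 * A - t) = v t.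
Proof.
  destruct (duffing_unique _ _ _ _ A (duffing_affine u v (-1) (-1) (2 * A) ltac:(ring) ltac:(ring) Hu) Hu) with (t := t)
    as [E1 E2].
  - replace (-1 * A + 2 * A) with A by ring. rewrite (proj1 (proj2 HA)). ring.
  - replace (-1 * A + 2 * A) with A by ring. ring.
  - replace (-1 * t + 2 * A) with (2 * A - t) in E1, E2 by ring. lra.
Qed.

Lemma u_half_period (t : R) : u (t + 2 * A) = - u t.
Proof.
  rewrite <- (proj1 (u_even (t + 2 * A))).
  replace (- (t + 2 * A)) with (2 * A - (t + 4 * A)) by ring.
  rewrite (proj1 (u_odd_about_quarter _)).
  f_equal. rewrite <- (proj1 (u_even t)).
  replace (t + 4 * A) with (2 * A - (- t - 2 * A)) by ring.
  rewrite (proj1 (u_odd_about_quarter _)).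
  replace (- t - 2 * A) with (- (2 * A - - t)) by ring.
  rewrite (proj1 (u_even _)), (proj1 (u_odd_about_quarter _)). ring.
Qed.

Lemma v_neg (t : R) : 0 < t <= A -> v t < 0.
Proof.
  intros Ht. apply v_neg_start; [lra|]. intros r Hr. apply HA. lra.
Qed.

Lemma u_decr (t t' : R) : 0 <= t -> t < t' -> t' <= 2 * A -> u t' < u t.
Proof.
  intros H1 H2 H3. apply (derive_neg_decr u v); [easy|intros; apply Hu|].
  intros r Hr. destruct (Rle_or_lt r A); [apply v_neg; lra|].
  rewrite <- (proj2 (u_odd_about_quarter r)). apply v_neg. lra.
Qed.

(** By strict decrease, [u] takes the value [d] on [[0, 2 * A]] only at 0; a candidate period
    between [2 * A] and [4 * A] is reflected to [4 * A - S]. *)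
Lemma duffing_minimal_period : 
  (forall t, u (t + 4 * A) = u t) /\
  forall S, 0 < S -> (forall t, u (t + S) = u t) -> 4 * A <= S.
Proof.
  assert (HP : forall t, u (t + 4 * A) = u t).
  { intros t. replace (t + 4 * A) with (t + 2 * A + 2 * A) by ring.
    rewrite !u_half_period. ring. }
  split; [easy|]. intros S HS HS'.
  destruct (Rle_or_lt (4 * A) S) as [|L]; [easy|exfalso].
  assert (E : u S = d) by (rewrite <- u_0, <- (HS' 0); f_equal; ring).
  destruct (Rle_or_lt S (2 * A)).
  - pose proof (u_decr 0 S). lra.
  - assert (E' : u (4 * A - S) = d).
    { rewrite <- E, <- (proj1 (u_even S)), <- (HP (- S)). f_equal. ring. }
    pose proof (u_decr 0 (4 * A - S)). lra.
Qed.

End Duffing.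

(** * Comparison of the sine-like solution with sub- and supersolutions *)

Lemma continuity_pt_near (f : R -> R) (x e : R) :
  continuity_pt f x -> 0 < e ->
  exists h, 0 < h /\ forall t, Rabs (t - x) < h -> Rabs (f t - f x) < e.
Proof.
  intros Hf He. destruct (Hf e He) as [h [Hh H]]. exists h. split; [easy|].
  intros t Ht. destruct (Req_dec t x) as [->|N].
  - now rewrite Rminus_diag, Rabs_R0.
  - apply H. repeat split; auto.
Qed.

Lemma negative_before (f : R -> R) (a x : R) :
  continuity_pt f x -> f x < 0 -> a < x -> exists t, a < t < x /\ f t < 0.
Proof.
  intros Hf Hx Ha. destruct (continuity_pt_near f x (- f x) Hf) as [h [Hh H]]; [lra|].
  set (k := Rmin h (x - a) / 2).
  assert (Hk : 0 < k /\ k < h /\ k < x - a).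
  { unfold k. pose proof (Rmin_l h (x - a)). pose proof (Rmin_r h (x - a)).
    assert (0 < Rmin h (x - a)) by (apply Rmin_pos; lra). lra. }
  exists (x - k). split; [lra|]. specialize (H (x - k)).
  rewrite Rabs_left in H by lra. specialize (H ltac:(lra)). apply Rabs_def2 in H. lra.
Qed.

Lemma positive_after (f : R -> R) (x b : R) :
  continuity_pt f x -> 0 < f x -> x < b ->
  exists h, 0 < h < b - x /\ forall t, x <= t <= x + h -> 0 < f t.
Proof.
  intros Hf Hx Hb. destruct (continuity_pt_near f x (f x) Hf) as [h [Hh H]]; [lra|].
  set (k := Rmin h (b - x) / 2).
  assert (Hk : 0 < k /\ k < h /\ k < b - x).
  { unfold k. pose proof (Rmin_l h (b - x)). pose proof (Rmin_r h (b - x)).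
    assert (0 < Rmin h (b - x)) by (apply Rmin_pos; lra). lra. }
  exists k. split; [lra|]. intros t Ht. specialize (H t).
  rewrite Rabs_right in H by lra. specialize (H ltac:(lra)). apply Rabs_def2 in H. lra.
Qed.

(** While [s > 0], the Wronskian [p * s1 - p1 * s] increases from 0. At a first zero [x] of [s1] it
    equals [- p1 x * s x], so [p1 x < 0]; concavity of [p] then carries a negative slope on to [A],
    against [0 <= p1 A]. *)
Lemma supersolution_sine (q s s1 p p1 p2 : R -> R) (A : R) :
  0 < A -> (forall t, 0 < q t) -> sol q s s1 -> s 0 = 0 -> s1 0 = 1 ->
  (forall t, is_derive p t (p1 t)) -> (forall t, is_derive p1 t (p2 t)) ->
  p 0 = 0 -> (forall t, 0 < t <= A -> 0 < p t) -> 0 <= p1 A ->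
  (forall t, 0 < t < A -> p2 t + q t * p t < 0) ->
  forall t, 0 <= t <= A -> 0 < s1 t.
Proof.
  intros HA Hq Hs S0 S10 Hp Hp1 P0 Pp P1A Hpq t Ht.
  destruct (Rlt_or_le 0 (s1 t)) as [|L]; [easy|exfalso].
  destruct (first_zero s1 0 t) as [x [Hx [Sx Sp]]]; auto; try lra.
  { intros. now apply (sol_continuity q s s1). }
  assert (Spos : forall r, 0 < r <= x -> 0 < s r).
  { intros r Hr. rewrite <- S0. apply (derive_pos_incr s s1); [lra|intros; apply Hs|].
    intros k Hk. apply Sp. lra. }
  assert (HW : p 0 * s1 0 - p1 0 * s 0 < p x * s1 x - p1 x * s x).
  { apply (derive_pos_incr (fun t => p t * s1 t - p1 t * s t)
      (fun t => p t * (- q t * s t) - p2 t * s t)); [lra| |].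
    - intros r _. destruct (Hs r). now apply (is_derive_wronskian p p1 p2 s s1 (fun t => - q t * s t)).
    - intros r Hr. specialize (Spos r ltac:(lra)). specialize (Hpq r ltac:(lra)). nra. }
  rewrite P0, S0, Sx in HW. specialize (Spos x ltac:(lra)).
  assert (P1x : p1 x < 0) by nra.
  destruct (Req_dec x A) as [->|N]; [lra|].
  assert (p1 A < p1 x); [|lra].
  apply (derive_neg_decr p1 p2); [lra|intros; apply Hp1|].
  intros r Hr. specialize (Hpq r ltac:(lra)). specialize (Pp r ltac:(lra)). specialize (Hq r). nra.
Qed.

(** If [s1] stayed positive, so would [s], and the Wronskian would decrease from 0 to [p A * s1 A],
    which is positive. *)
Lemma subsolution_sine (q s s1 p p1 p2 : R -> R) (A : R) :
  0 < A -> sol q s s1 -> s 0 = 0 ->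
  (forall t, is_derive p t (p1 t)) -> (forall t, is_derive p1 t (p2 t)) ->
  p 0 = 0 -> 0 < p A -> p1 A = 0 ->
  (forall t, 0 < t < A -> 0 < p2 t + q t * p t) ->
  ~ (forall t, 0 <= t <= A -> 0 < s1 t).
Proof.
  intros HA Hs S0 Hp Hp1 P0 PA P1A Hpq H.
  assert (HW : p A * s1 A - p1 A * s A < p 0 * s1 0 - p1 0 * s 0).
  { apply (derive_neg_decr (fun t => p t * s1 t - p1 t * s t)
      (fun t => p t * (- q t * s t) - p2 t * s t)); [lra| |].
    - intros r _. destruct (Hs r). now apply (is_derive_wronskian p p1 p2 s s1 (fun t => - q t * s t)).
    - intros r Hr. specialize (Hpq r ltac:(lra)).
      assert (0 < s r).
      { rewrite <- S0. apply (derive_pos_incr s s1); [lra|intros; apply Hs|].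
        intros; apply H; lra. }
      nra. }
  rewrite P0, S0, P1A in HW. specialize (H A ltac:(lra)). nra.
Qed.

(** * The Hill equation in the time variable that makes the Duffing orbit independent of [w] *)

Definition potential (w : R) (u : R -> R) (t : R) : R := w ^ 2 + w * u t ^ 2.

Definition sine (q s s1 : R -> R) : Prop := sol q s s1 /\ s 0 = 0 /\ s1 0 = 1.
Definition cosine (q c c1 : R -> R) : Prop := sol q c c1 /\ c 0 = 1 /\ c1 0 = 0.

(** [below_sine_edge w u A]: [w] lies below the edge at which the sine-like solution becomes
    antiperiodic. *)
Definition below_sine_edge (w : R) (u : R -> R) (A : R) : Prop :=
  forall s s1, sine (potential w u) s s1 -> forall t, 0 <= t <= A -> 0 < s1 t.

Section Comparison.

Variables (d : R) (u v : R -> R) (A : R).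
Hypothesis Hd : 0 < d.
Hypothesis Hu : duffing u v.
Hypothesis u_0 : u 0 = d.
Hypothesis v_0 : v 0 = 0.
Hypothesis HA : quarter_period u A.

Lemma u_sq_le (t : R) : 0 <= u t ^ 2 <= d ^ 2.
Proof.
  split; [apply pow2_ge_0|]. rewrite <- pow2_abs. apply pow_incr.
  split; [apply Rabs_pos|]. now apply (duffing_abs_le d u v).
Qed.

Lemma potential_pos (w : R) : 0 < w -> forall t, 0 < potential w u t.
Proof. intros Hw t. unfold potential. pose proof (u_sq_le t). nra. Qed.

Lemma potential_bound (w : R) :
  0 < w -> forall t, Rabs (potential w u t) <= w ^ 2 + w * d ^ 2.
Proof.
  intros Hw t. rewrite Rabs_right by (apply Rgt_ge, potential_pos; easy).
  unfold potential. pose proof (u_sq_le t). nra.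
Qed.

Lemma potential_even (w t : R) : potential w u (- t) = potential w u t.
Proof. unfold potential. now rewrite (proj1 (u_even u v Hu v_0 t)). Qed.

Lemma potential_refl (w t : R) : potential w u (2 * A - t) = potential w u t.
Proof. unfold potential. rewrite (proj1 (u_odd_about_quarter u v Hu A HA t)). ring. Qed.

Lemma potential_continuous (w t : R) : continuous (potential w u) t.
Proof.
  apply (ex_derive_continuous (V := R_NormedModule)). unfold potential. auto_derive.
  repeat split. eexists. exact (proj1 (Hu t)).
Qed.

Lemma potential_incr (w w' t : R) : 0 < w < w' -> potential w u t < potential w' u t.
Proof. intros Hw. unfold potential. pose proof (u_sq_le t). nra. Qed.

Lemma ex_sine (w : R) : 0 < w -> exists s s1, sine (potential w u) s s1.
Proof.
  intros Hw. apply (ex_sol (potential w u) (w ^ 2 + w * d ^ 2) 0 1).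
  - apply potential_continuous.
  - now apply potential_bound.
Qed.

Lemma ex_cosine (w : R) : 0 < w -> exists c c1, cosine (potential w u) c c1.
Proof.
  intros Hw. apply (ex_sol (potential w u) (w ^ 2 + w * d ^ 2) 1 0).
  - apply potential_continuous.
  - now apply potential_bound.
Qed.

Lemma sine_unique (w : R) (s s1 r r1 : R -> R) :
  0 < w -> sine (potential w u) s s1 -> sine (potential w u) r r1 ->
  forall t, s t = r t /\ s1 t = r1 t.
Proof.
  intros Hw [H1 [E1 F1]] [H2 [E2 F2]].
  apply (sol_unique (potential w u) s s1 r r1 (w ^ 2 + w * d ^ 2) 0); auto; try congruence.
  now apply potential_bound.
Qed.

(* [- v] is the sine-like solution for the potential [1 + 3 * u ^ 2]; the factor
   [1 - k * u ^ 2] corrects it to a sub- or supersolution for the potential at [w]. *)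
Definition test (k t : R) : R := - v t * (1 - k * u t ^ 2).
Definition test1 (k t : R) : R :=
  (u t + u t ^ 3) * (1 - k * u t ^ 2) + 2 * k * u t * v t ^ 2.
Definition test2 (k t : R) : R :=
  v t * (1 + 3 * u t ^ 2) * (1 - k * u t ^ 2) - 2 * k * u t * v t * (u t + u t ^ 3)
  + 2 * k * v t ^ 3 - 4 * k * u t * v t * (u t + u t ^ 3).
Definition test_residual (k w x : R) : R :=
  (w ^ 2 - 1 - 2 * k * energy d) + (8 * k - (3 - w) - (w ^ 2 - 1) * k) * x
  + k * (10 - w) * x ^ 2.

Lemma test_derive (k t : R) :
  is_derive (test k) t (test1 k t) /\ is_derive (test1 k) t (test2 k t).
Proof.
  destruct (Hu t) as [H1 H2]. unfold test, test1, test2. split.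
  - auto_derive; [repeat split; eexists; eassumption|].
    rewrite (Derive_eta u t _ H1), (Derive_eta v t _ H2). ring.
  - auto_derive; [repeat split; eexists; eassumption|].
    rewrite (Derive_eta u t _ H1), (Derive_eta v t _ H2). ring.
Qed.

(** Eliminating [v ^ 2] by the energy leaves [- v], positive on [(0, A]], times a quadratic
    polynomial in [u ^ 2]. The sign of that polynomial on [(0, d ^ 2)] therefore decides between
    sub- and supersolution. *)
Lemma test_equation (k w t : R) :
  test2 k t + potential w u t * test k t = - v t * test_residual k w (u t ^ 2).
Proof.
  pose proof (duffing_velocity d u v Hu u_0 v_0 t) as E.
  unfold test2, test, test_residual, potential.
  replace (energy d) with (v t ^ 2 + u t ^ 2 + u t ^ 4 / 2) by lra. field.
Qed.

Lemma test_boundary (k : R) :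
  k * d ^ 2 < 1 -> 0 <= k ->
  test k 0 = 0 /\ test1 k A = 0 /\ forall t, 0 < t <= A -> 0 < test k t.
Proof.
  intros Hk Hk0. unfold test, test1. split; [|split].
  - rewrite v_0. ring.
  - rewrite (proj1 (proj2 HA)). ring.
  - intros t Ht. pose proof (v_neg u v Hu v_0 A HA t Ht). pose proof (u_sq_le t).
    apply Rmult_lt_0_compat; [lra|]. nra.
Qed.

Lemma u_sq_lt (t : R) : 0 < t < A -> 0 < u t ^ 2 < d ^ 2.
Proof.
  intros Ht. assert (0 < u t) by (apply HA; lra).
  assert (u t < d).
  { rewrite <- u_0. apply (u_decr u v Hu v_0 A HA); lra. }
  split; [now apply pow_lt|nra].
Qed.

Lemma below_sine_edge_test (k w : R) :
  0 < w -> 0 <= k -> k * d ^ 2 < 1 ->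
  (forall x, 0 < x < d ^ 2 -> test_residual k w x < 0) ->
  below_sine_edge w u A.
Proof.
  intros Hw Hk Hkd Hx s s1 [Hs [S0 S1]].
  destruct (test_boundary k Hkd Hk) as [T0 [T1 Tp]].
  apply (supersolution_sine (potential w u) s s1 (test k) (test1 k) (test2 k)); auto.
  - apply HA.
  - now apply potential_pos.
  - intros; apply test_derive.
  - intros; apply test_derive.
  - lra.
  - intros t Ht. rewrite test_equation. specialize (Hx _ (u_sq_lt t Ht)).
    pose proof (v_neg u v Hu v_0 A HA t ltac:(lra)). nra.
Qed.

Lemma not_below_sine_edge_test (k w : R) :
  0 < w -> 0 <= k -> k * d ^ 2 < 1 ->
  (forall x, 0 < x < d ^ 2 -> 0 < test_residual k w x) ->
  ~ below_sine_edge w u A.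
Proof.
  intros Hw Hk Hkd Hx H.
  destruct (test_boundary k Hkd Hk) as [T0 [T1 Tp]].
  destruct (ex_sine w Hw) as [s [s1 Hs]].
  apply (subsolution_sine (potential w u) s s1 (test k) (test1 k) (test2 k) A); try apply Hs; auto.
  - apply HA.
  - intros; apply test_derive.
  - intros; apply test_derive.
  - apply Tp. split; [apply HA|lra].
  - intros t Ht. rewrite test_equation. specialize (Hx _ (u_sq_lt t Ht)).
    pose proof (v_neg u v Hu v_0 A HA t ltac:(lra)). nra.
  - exact (H s s1 Hs).
Qed.

Lemma sine_incr_pos (w : R) (s s1 : R -> R) (x : R) :
  sine (potential w u) s s1 -> (forall t, 0 < t < x -> 0 <= s1 t) ->
  forall t, 0 < t <= x -> 0 < s t.
Proof.
  intros [Hs [S0 S1]] H t Ht.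
  destruct (positive_start s 1 t) as [h [Hh Sh]]; [lra| |easy|lra|].
  { rewrite <- S1. apply Hs. }
  destruct (MVT_is_derive s s1 h t) as [r [Hr E]]; [lra|intros; apply Hs|].
  specialize (H r ltac:(lra)). nra.
Qed.

(** The sine-like solution at [w'] is itself a supersolution at the smaller [w], where the potential
    is smaller. *)
Lemma below_sine_edge_mono (w w' : R) :
  0 < w < w' -> below_sine_edge w' u A -> below_sine_edge w u A.
Proof.
  intros Hw H s s1 [Hs [S0 S1]].
  destruct (ex_sine w' ltac:(lra)) as [r [r1 Hr]]. specialize (H r r1 Hr).
  pose proof Hr as [Hr' [R0 R1]].
  assert (Rp : forall t, 0 < t <= A -> 0 < r t).
  { apply (sine_incr_pos w' r r1 A Hr). intros t Ht. apply Rlt_le, H. lra. }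
  destruct HA as [HA0 _].
  apply (supersolution_sine (potential w u) s s1 r r1 (fun t => - potential w' u t * r t)); auto.
  - apply potential_pos. lra.
  - intros; apply Hr'.
  - intros; apply Hr'.
  - apply Rlt_le, H. lra.
  - intros t Ht. specialize (Rp t ltac:(lra)). pose proof (potential_incr w w' t Hw). nra.
Qed.

(** If [r1 >= 0] throughout, [r] would be a supersolution at [w]. The strict inequality at an
    interior point is what persists when the amplitude is perturbed. *)
Lemma beyond_sine_edge (w w' : R) (r r1 : R -> R) :
  0 < w < w' -> ~ below_sine_edge w u A -> sine (potential w' u) r r1 ->
  exists t, 0 < t < A /\ r1 t < 0.
Proof.
  intros Hw H Hr.
  destruct (Classical_Prop.classic (exists t, 0 < t < A /\ r1 t < 0)) as [|Hn]; [easy|exfalso].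
  apply H. intros s s1 [Hs [S0 S1]].
  assert (Hr1 : forall t, 0 < t < A -> 0 <= r1 t).
  { intros t Ht. destruct (Rle_or_lt 0 (r1 t)); [easy|]. exfalso. apply Hn. now exists t. }
  assert (Rp := sine_incr_pos w' r r1 A Hr Hr1).
  pose proof Hr as [Hr' [R0 R1]].
  destruct HA as [HA0 _].
  apply (supersolution_sine (potential w u) s s1 r r1 (fun t => - potential w' u t * r t)); auto.
  - apply potential_pos. lra.
  - intros; apply Hr'.
  - intros; apply Hr'.
  - destruct (Rle_or_lt 0 (r1 A)) as [|L]; [easy|exfalso].
    destruct (negative_before r1 0 A) as [t Ht]; auto.
    + now apply (sol_continuity (potential w' u) r r1).
    + apply Hn. now exists t.
  - intros t Ht. specialize (Rp t ltac:(lra)). pose proof (potential_incr w w' t Hw). nra.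
Qed.

(** At a first zero [x < A] of [s1] one has [s x > 0], so [s1] crosses to negative values. A first
    zero at [A] itself is the edge, where the trace is [-2]. *)
Lemma sine_edge_dichotomy (w : R) (s s1 : R -> R) :
  0 < w -> sine (potential w u) s s1 -> ~ below_sine_edge w u A ->
  s1 A = 0 \/ exists t, 0 < t < A /\ s1 t < 0.
Proof.
  intros Hw Hs H.
  destruct (Classical_Prop.classic (exists t, 0 <= t <= A /\ s1 t <= 0)) as [[t [Ht St]]|Hn].
  - pose proof Hs as [Hs' [S0 S1]].
    destruct (first_zero s1 0 t) as [x [Hx [Sx Sp]]]; auto; try lra.
    { intros. now apply (sol_continuity (potential w u) s s1). }
    destruct (Req_dec x A) as [->|N]; [now left|right].
    assert (Sxp : 0 < s x).
    { apply (sine_incr_pos w s s1 x Hs); [|lra]. intros; apply Rlt_le, Sp; lra. }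
    destruct (positive_after s x A) as [h [Hh Hp]]; auto; [now apply (sol_continuity (potential w u) s s1)|lra|].
    exists (x + h). split; [lra|]. rewrite <- Sx.
    apply (derive_neg_decr s1 (fun t => - potential w u t * s t)); [lra|intros; apply Hs'|].
    intros r Hr. specialize (Hp r ltac:(lra)). pose proof (potential_pos w Hw r). nra.
  - exfalso. apply H. intros r r1 Hr t Ht.
    rewrite <- (proj2 (sine_unique w s s1 r r1 Hw Hs Hr t)).
    destruct (Rlt_or_le 0 (s1 t)); [easy|]. exfalso. apply Hn. now exists t.
Qed.

Lemma u_sol : sol (potential 1 u) u v.
Proof.
  intros t. destruct (Hu t) as [H1 H2]. split; [easy|].
  replace (- potential 1 u t * u t) with (- (u t + u t ^ 3)) by (unfold potential; ring). easy.
Qed.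

Lemma is_derive_wronskian_u (w : R) (c c1 : R -> R) (t : R) :
  sol (potential w u) c c1 ->
  is_derive (fun t => u t * c1 t - v t * c t) t
    ((potential 1 u t - potential w u t) * (u t * c t)).
Proof.
  intros Hc. destruct (Hc t), (u_sol t).
  replace ((potential 1 u t - potential w u t) * (u t * c t))
    with (u t * (- potential w u t * c t) - (- potential 1 u t * u t) * c t) by ring.
  now apply (is_derive_wronskian u v (fun t => - potential 1 u t * u t) c c1
    (fun t => - potential w u t * c t)).
Qed.

(** The Wronskian [u * c1 - v * c] starts at 0 and increases while [c > 0], as the potential at [w]
    is below that at 1. At a first zero [x] of [c] it reduces to [u x * c1 x], which is not
    positive. *)
Lemma cosine_pos_below_1 (w : R) (c c1 : R -> R) :
  0 < w < 1 -> cosine (potential w u) c c1 -> forall t, 0 <= t <= A -> 0 < c t.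
Proof.
  intros Hw [Hc [C0 C1]] t Ht. destruct (Rlt_or_le 0 (c t)) as [|L]; [easy|exfalso].
  destruct (first_zero c 0 t) as [x [Hx [Cx Cp]]]; auto; try lra.
  { intros. now apply (sol_continuity (potential w u) c c1). }
  assert (HW : u 0 * c1 0 - v 0 * c 0 < u x * c1 x - v x * c x).
  { apply (derive_pos_incr (fun t => u t * c1 t - v t * c t)
      (fun t => (potential 1 u t - potential w u t) * (u t * c t))); [lra| |].
    - intros; now apply is_derive_wronskian_u.
    - intros r Hr. specialize (Cp r ltac:(lra)).
      assert (0 < u r) by (apply HA; lra).
      pose proof (potential_incr w 1 r Hw).
      apply Rmult_lt_0_compat; [lra|]. now apply Rmult_lt_0_compat. }
  rewrite C1, v_0, Cx in HW.
  assert (c1 x < 0).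
  { rewrite <- C1. apply (derive_neg_decr c1 (fun t => - potential w u t * c t)); [easy|intros; apply Hc|].
    intros r Hr. specialize (Cp r ltac:(lra)). pose proof (potential_pos w ltac:(lra) r). nra. }
  destruct (Req_dec x A) as [->|].
  - rewrite (proj1 (proj2 HA)) in HW. lra.
  - assert (0 < u x) by (apply HA; lra). nra.
Qed.

(** If [c] stayed positive inside, its Wronskian with [u] would decrease from 0 to [- v A * c A]. As
    [v A < 0], this makes [c A] negative, and the intermediate value theorem yields a zero after
    all. *)
Lemma cosine_zero_above_1 (w : R) (c c1 : R -> R) :
  1 < w -> cosine (potential w u) c c1 -> exists x, 0 < x < A /\ c x = 0.
Proof.
  intros Hw [Hc [C0 C1]].
  assert (Cc : forall t, continuity_pt c t) by (intros; now apply (sol_continuity (potential w u) c c1)).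
  destruct (Classical_Prop.classic (exists x, 0 < x < A /\ c x = 0)) as [|Hn]; [easy|exfalso].
  assert (Cp : forall t, 0 < t < A -> 0 < c t).
  { intros t Ht. destruct (Rlt_or_le 0 (c t)) as [|L]; [easy|exfalso].
    destruct (first_zero c 0 t) as [x [Hx [Cx _]]]; auto; try lra.
    apply Hn. exists x. split; [lra|easy]. }
  pose proof HA as [HA0 [UA Up]].
  assert (HW : u A * c1 A - v A * c A < u 0 * c1 0 - v 0 * c 0).
  { apply (derive_neg_decr (fun t => u t * c1 t - v t * c t)
      (fun t => (potential 1 u t - potential w u t) * (u t * c t))); [lra| |].
    - intros; now apply is_derive_wronskian_u.
    - intros r Hr. specialize (Cp r Hr). specialize (Up r ltac:(lra)).
      pose proof (potential_incr 1 w r ltac:(lra)).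
      assert (0 < u r * c r) by now apply Rmult_lt_0_compat. nra. }
  rewrite C1, v_0, UA in HW. pose proof (v_neg u v Hu v_0 A HA A ltac:(lra)).
  assert (c A < 0) by nra.
  destruct (IVT_strict c 0 A) as [x Hx]; auto; [rewrite C0; lra|].
  apply Hn. now exists x.
Qed.

Lemma cosine_at_1 (c c1 : R -> R) : cosine (potential 1 u) c c1 -> c A = 0.
Proof.
  intros [Hc [C0 C1]].
  assert (E := wronskian_const _ u v c c1 u_sol Hc A 0).
  rewrite (proj1 (proj2 HA)), v_0, C1 in E.
  pose proof (v_neg u v Hu v_0 A HA A ltac:(destruct HA; lra)). nra.
Qed.

Lemma below_sine_edge_1 : below_sine_edge 1 u A.
Proof.
  (* With [k = 0] the test function is [- v] and the residual is [(w ^ 2 - 1) - (3 - w) * x], here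
     [- 2 * x]. *)
  apply below_sine_edge_test with 0; try lra.
  intros x Hx. unfold test_residual. lra.
Qed.

Lemma not_below_sine_edge_3 (w : R) : 3 <= w -> ~ below_sine_edge w u A.
Proof.
  intros Hw. apply not_below_sine_edge_test with 0; try lra.
  intros x Hx. unfold test_residual. nra.
Qed.

Lemma not_below_sine_edge_small :
  d <= 1 -> ~ below_sine_edge (1 + energy d / 4) u A.
Proof.
  intros Hd1. set (x := energy d / 4).
  assert (Hd2 : 0 < d ^ 2 <= 1) by nra.
  assert (Hx : 0 < x <= 1 / 2) by (unfold x, energy; nra).
  assert (Ex : energy d = 4 * x) by (unfold x; field).
  (* This is [(w ^ 2 - 1) / (2 * energy d)] at [w = 1 + x], [energy d = 4 * x], so the constant term
     of the residual vanishes. In the linear coefficient [8 * k - (3 - w)] equals [2 * x], which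
     outweighs the remaining term because [x <= 1 / 2]. *)
  apply not_below_sine_edge_test with ((2 + x) / 8); try nra.
  intros y Hy. unfold test_residual. rewrite Ex.
  replace ((1 + x) ^ 2 - 1 - 2 * ((2 + x) / 8) * (4 * x)) with 0 by field.
  assert (0 <= 8 * ((2 + x) / 8) - (3 - (1 + x)) - ((1 + x) ^ 2 - 1) * ((2 + x) / 8)) by nra.
  assert (0 < (2 + x) / 8 * (10 - (1 + x)) * y ^ 2).
  { apply Rmult_lt_0_compat; [nra|]. apply pow_lt. lra. }
  nra.
Qed.

Lemma below_sine_edge_large (w : R) :
  1 < w < 3 -> 100 / (3 - w) < d ^ 2 -> below_sine_edge w u A.
Proof.
  intros Hw Hdw.
  assert (Hd2 : 50 < d ^ 2).
  { apply Rle_lt_trans with (2 := Hdw).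
    apply (Rmult_le_reg_r (3 - w)); [lra|].
    replace (100 / (3 - w) * (3 - w)) with 100 by (field; lra). lra. }
  assert (HE : d ^ 4 / 2 <= energy d) by (unfold energy; nra).
  assert (Hnd : 100 < (3 - w) * d ^ 2).
  { apply (Rmult_lt_compat_r (3 - w)) in Hdw; [|lra].
    replace (100 / (3 - w) * (3 - w)) with 100 in Hdw by (field; lra). lra. }
  assert (Hd4 : 0 < d ^ 4) by (apply pow_lt; easy).
  set (k := (w ^ 2 - 1) / (2 * energy d)).
  assert (Hm : 0 < w ^ 2 - 1 < 8) by nra.
  assert (Hk0 : 0 < k) by (apply Rdiv_lt_0_compat; lra).
  assert (Ek : 2 * k * energy d = w ^ 2 - 1) by (unfold k; field; lra).
  (* From [d ^ 4 <= 2 * energy d] and [w ^ 2 - 1 < 8]: [k] decays like [d ^ -4]. *)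
  assert (Hk : k * d ^ 2 * d ^ 2 < 8) by nra.
  set (D := d ^ 2) in *.
  assert (HkD : k * D < 8 / 50) by nra.
  apply below_sine_edge_test with k; try lra.
  - fold D. lra.
  - fold D. intros x Hx. unfold test_residual. rewrite Ek.
    (* After multiplication by [D] the left side is below [8 * 8 / 50 + 9 * 8], and the right side
       exceeds 100; this is the source of the threshold [100 / (3 - w)]. *)
    assert (Hn : 8 * k + k * (10 - w) * D < 3 - w).
    { apply (Rmult_lt_reg_r D); [lra|]. nra. }
    assert (k * (10 - w) * x ^ 2 <= k * (10 - w) * D * x).
    { replace (k * (10 - w) * D * x) with (k * (10 - w) * (D * x)) by ring.
      apply Rmult_le_compat_l; nra. }
    assert (0 < (3 - w - (8 * k + k * (10 - w) * D)) * x) by (apply Rmult_lt_0_compat; lra).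
    assert (0 < (w ^ 2 - 1) * k * x) 
      by (apply Rmult_lt_0_compat; [apply Rmult_lt_0_compat|]; lra).
    lra.
Qed.

End Comparison.

(** * Dependence on the amplitude *)

(** As the exponential [K] is at least 1, [K <= K ^ 2], which gives a bound without square roots. *)
Lemma abs_le_of_gronwall (x y a M L t : R) :
  0 <= M -> 0 <= t <= L -> 0 <= a ->
  x ^ 2 + y ^ 2 <= a ^ 2 * exp ((M + 2) * t) ->
  Rabs x <= a * exp ((M + 2) * L) /\ Rabs y <= a * exp ((M + 2) * L).
Proof.
  intros HM Ht Ha H.
  set (K := exp ((M + 2) * L)).
  assert (HK : exp ((M + 2) * t) <= K).
  { unfold K. destruct (proj2 Ht) as [L'| -> ]; [|lra]. apply Rlt_le, exp_increasing. nra. }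
  assert (HK1 : 1 <= K).
  { unfold K. rewrite <- exp_0. destruct (Req_dec L 0) as [->|]; [rewrite Rmult_0_r; lra|].
    apply Rlt_le, exp_increasing. nra. }
  assert (HS : x ^ 2 + y ^ 2 <= (a * K) ^ 2).
  { apply Rle_trans with (1 := H). rewrite Rpow_mult_distr.
    apply Rmult_le_compat_l; [apply pow2_ge_0|nra]. }
  pose proof (pow2_ge_0 x). pose proof (pow2_ge_0 y).
  assert (HaK : 0 <= a * K) by nra.
  split; rewrite <- (Rabs_pos_eq (a * K)) by easy; apply Rsqr_le_abs_0; unfold Rsqr; lra.
Qed.

Section Family.

Variables (U V : R -> R -> R).
Hypothesis HU : forall d, 0 < d -> duffing (U d) (V d).
Hypothesis U_0 : forall d, 0 < d -> U d 0 = d.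
Hypothesis V_0 : forall d, 0 < d -> V d 0 = 0.

Lemma U_abs_le (d t : R) : 0 < d -> Rabs (U d t) <= d.
Proof. intros Hd. apply (duffing_abs_le d (U d) (V d)); auto. Qed.

Lemma U_dependence (d0 L e : R) :
  0 < d0 -> 0 < e -> exists h, 0 < h /\ forall d, 0 < d -> Rabs (d - d0) < h ->
  forall t, 0 <= t <= L -> Rabs (U d t - U d0 t) < e.
Proof.
  intros Hd0 He.
  set (M := 1 + 3 * (d0 + 1) ^ 2).
  assert (HM : 0 <= M) by (unfold M; nra).
  set (K := exp ((M + 2) * L)). assert (HK : 0 < K) by apply exp_pos.
  exists (Rmin 1 (e / K)).
  assert (HeK : 0 < e / K) by now apply Rdiv_lt_0_compat.
  split; [apply Rmin_pos; lra|]. intros d Hd Hdd t Ht.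
  pose proof (Rmin_l 1 (e / K)). pose proof (Rmin_r 1 (e / K)).
  assert (Hd1 : Rabs (d - d0) < 1) by lra. apply Rabs_def2 in Hd1.
  assert (HS := duffing_diff _ _ _ _ (HU d Hd) (HU d0 Hd0)).
  assert (G := gronwall (fun t => U d t - U d0 t) (fun t => V d t - V d0 t)
    (fun t => 1 + U d t ^ 2 + U d t * U d0 t + U d0 t ^ 2) (fun _ => 0) M 0 L).
  assert (G' : forall t, 0 <= t <= L -> (U d t - U d0 t) ^ 2 + (V d t - V d0 t) ^ 2 <=
    Rabs (d - d0) ^ 2 * exp ((M + 2) * t)).
  { intros r Hr. rewrite pow2_abs.
    replace ((d - d0) ^ 2) with ((U d 0 - U d0 0) ^ 2 + (V d 0 - V d0 0) ^ 2 + 0 ^ 2)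
      by (rewrite !U_0, !V_0 by easy; ring).
    apply G; auto.
    - intros s _. exact (proj1 (HS s)).
    - intros s _. rewrite Rplus_0_r. exact (proj2 (HS s)).
    - intros s _. apply duffing_diff_bound.
      + apply Rle_trans with d; [now apply U_abs_le|lra].
      + apply Rle_trans with d0; [now apply U_abs_le|lra].
    - intros s _. rewrite Rabs_R0. lra. }
  destruct (abs_le_of_gronwall _ _ (Rabs (d - d0)) M L t HM Ht (Rabs_pos _) (G' t Ht)) as [B _].
  fold K in B. apply Rle_lt_trans with (1 := B).
  apply Rlt_le_trans with (e / K * K); [apply Rmult_lt_compat_r; lra|].
  right. field. lra.
Qed.

Lemma potential_dependence (d0 w0 L e : R) :
  0 < d0 -> 0 < w0 -> 0 < e -> exists h, 0 < h <= 1 /\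
  forall d w, 0 < d -> 0 < w -> Rabs (d - d0) < h -> Rabs (w - w0) < h ->
  forall t, 0 <= t <= L -> Rabs (potential w (U d) t - potential w0 (U d0) t) <= e.
Proof.
  intros Hd0 Hw0 He.
  (* A Lipschitz constant of the potential within distance 1 of the base point; its three summands
     match the three terms of the decomposition below. *)
  set (B := (2 * w0 + 1) + (d0 + 1) ^ 2 + w0 * (2 * (d0 + 1))).
  assert (HB : 0 < B) by (unfold B; nra).
  set (e1 := e / B). assert (He1 : 0 < e1) by now apply Rdiv_lt_0_compat.
  destruct (U_dependence d0 L e1 Hd0 He1) as [h [Hh H]].
  exists (Rmin (Rmin 1 e1) h).
  pose proof (Rmin_l (Rmin 1 e1) h). pose proof (Rmin_r (Rmin 1 e1) h).
  pose proof (Rmin_l 1 e1). pose proof (Rmin_r 1 e1).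
  split.
  { split; [|lra]. repeat apply Rmin_pos; lra. }
  intros d w Hd Hw Hdd Hww t Ht.
  assert (Ht1 := H d Hd ltac:(lra) t Ht).
  assert (HU1 := U_abs_le d t Hd). assert (HU0 := U_abs_le d0 t Hd0).
  assert (Hdd1 : Rabs (d - d0) < 1) by lra. apply Rabs_def2 in Hdd1.
  assert (Hw1 : Rabs (w - w0) <= e1) by lra.
  assert (Hw2 : Rabs (w - w0) < 1) by lra. apply Rabs_def2 in Hw2.
  unfold potential.
  replace (w ^ 2 + w * U d t ^ 2 - (w0 ^ 2 + w0 * U d0 t ^ 2))
    with ((w - w0) * (w + w0) + (w - w0) * U d t ^ 2
       + w0 * ((U d t - U d0 t) * (U d t + U d0 t))) by ring.
  apply Rle_trans with (e1 * (2 * w0 + 1) + e1 * (d0 + 1) ^ 2 + w0 * (e1 * (2 * (d0 + 1)))).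
  - eapply Rle_trans; [apply Rabs_triang|]. apply Rplus_le_compat.
    + eapply Rle_trans; [apply Rabs_triang|]. apply Rplus_le_compat; rewrite Rabs_mult;
        apply Rmult_le_compat; try apply Rabs_pos; try easy.
      * rewrite Rabs_right; lra.
      * rewrite <- RPow_abs. apply pow_incr. split; [apply Rabs_pos|lra].
    + rewrite !Rabs_mult, (Rabs_right w0) by lra.
      apply Rmult_le_compat_l; [lra|].
      apply Rmult_le_compat; try apply Rabs_pos; [lra|].
      eapply Rle_trans; [apply Rabs_triang|]. lra.
  - right. unfold e1, B. field. unfold B in HB. lra.
Qed.

Lemma sine_dependence (d0 w0 L e : R) (r r1 : R -> R) :
  0 < d0 -> 0 < w0 -> 0 < e -> sine (potential w0 (U d0)) r r1 ->
  exists h, 0 < h /\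
  forall d w s s1, 0 < d -> 0 < w -> Rabs (d - d0) < h -> Rabs (w - w0) < h ->
  sine (potential w (U d)) s s1 ->
  forall t, 0 <= t <= L -> Rabs (s1 t - r1 t) < e.
Proof.
  intros Hd0 Hw0 He [Hr [R0 R1]].
  set (M := (w0 + 1) ^ 2 + (w0 + 1) * (d0 + 1) ^ 2).
  assert (HM : 0 <= M) by (unfold M; nra).
  set (K := exp ((M + 2) * L)). assert (HK : 0 < K) by apply exp_pos.
  assert (HQ0 : forall t, Rabs (potential w0 (U d0) t) <= M).
  { intros t. eapply Rle_trans; [apply (potential_bound d0 (U d0) (V d0)); auto|].
    unfold M. nra. }
  assert (HrK : forall t, 0 <= t <= L -> Rabs (r t) <= K).
  { intros t Ht.
    assert (G := gronwall r r1 (potential w0 (U d0)) (fun _ => 0) M 0 L).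
    assert (G' : r t ^ 2 + r1 t ^ 2 <= 1 ^ 2 * exp ((M + 2) * t)).
    { replace (1 ^ 2) with (r 0 ^ 2 + r1 0 ^ 2 + 0 ^ 2) by (rewrite R0, R1; ring).
      apply G; auto.
      - intros s _. exact (proj1 (Hr s)).
      - intros s _. rewrite Rplus_0_r. exact (proj2 (Hr s)).
      - intros s _. rewrite Rabs_R0. lra. }
    destruct (abs_le_of_gronwall _ _ 1 M L t HM Ht ltac:(lra) G') as [B _].
    rewrite Rmult_1_l in B. exact B. }
  (* One factor [K] bounds the solution [r] in the forcing term, the other is the Gronwall factor
     for the difference [s - r], and the 2 makes the estimate strict. *)
  set (p := e / (2 * K * K)).
  assert (Hp : 0 < p) by (apply Rdiv_lt_0_compat; nra).
  destruct (potential_dependence d0 w0 L p Hd0 Hw0 Hp) as [h [Hh H]].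
  exists h. split; [lra|]. intros d w s s1 Hd Hw Hdd Hww [Hs [S0 S1]] t Ht.
  assert (Hdd1 : Rabs (d - d0) < 1) by lra. apply Rabs_def2 in Hdd1.
  assert (Hw2 : Rabs (w - w0) < 1) by lra. apply Rabs_def2 in Hw2.
  assert (G := gronwall (fun t => s t - r t) (fun t => s1 t - r1 t) (potential w (U d))
    (fun t => - (potential w (U d) t - potential w0 (U d0) t) * r t) M (p * K) L).
  assert (G' : (s t - r t) ^ 2 + (s1 t - r1 t) ^ 2 <= (p * K) ^ 2 * exp ((M + 2) * t)).
  { replace ((p * K) ^ 2) with ((s 0 - r 0) ^ 2 + (s1 0 - r1 0) ^ 2 + (p * K) ^ 2)
      by (rewrite S0, S1, R0, R1; ring).
    apply G; auto.
    - intros x _. apply (is_derive_minus s r); [exact (proj1 (Hs x))|exact (proj1 (Hr x))].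
    - intros x _.
      replace (- potential w (U d) x * (s x - r x) +
        - (potential w (U d) x - potential w0 (U d0) x) * r x)
        with (- potential w (U d) x * s x - - potential w0 (U d0) x * r x) by ring.
      apply (is_derive_minus s1 r1); [exact (proj2 (Hs x))|exact (proj2 (Hr x))].
    - intros x _. eapply Rle_trans; [apply (potential_bound d (U d) (V d)); auto|].
      unfold M. apply Rplus_le_compat; [apply pow_incr; lra|].
      apply Rmult_le_compat; [lra|apply pow2_ge_0|lra|apply pow_incr; lra].
    - intros x Hx. rewrite Rabs_mult, Rabs_Ropp.
      apply Rmult_le_compat; try apply Rabs_pos; auto. }
  assert (HpK : 0 <= p * K) by nra.
  destruct (abs_le_of_gronwall _ _ (p * K) M L t HM Ht HpK G') as [_ B].
  fold K in B. apply Rle_lt_trans with (1 := B).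
  replace (p * K * K) with (e / 2) by (unfold p; field; lra). lra.
Qed.

(** Positivity of [r1] extends to a fixed [[0, L]] with [L] slightly beyond [A0], where it has a
    positive minimum. Since [U d0 L < 0], nearby orbits are negative at [L] too, so their quarter
    periods stay below [L]. *)
Lemma below_sine_edge_open (d0 w0 A0 : R) :
  0 < d0 -> 0 < w0 -> quarter_period (U d0) A0 -> below_sine_edge w0 (U d0) A0 ->
  exists h, 0 < h /\ forall d w A, 0 < d -> 0 < w -> Rabs (d - d0) < h -> Rabs (w - w0) < h ->
  quarter_period (U d) A -> below_sine_edge w (U d) A.
Proof.
  intros Hd0 Hw0 HA0 Hb.
  destruct (ex_sine d0 (U d0) (V d0) Hd0 (HU d0 Hd0) (U_0 d0 Hd0) (V_0 d0 Hd0) w0 Hw0) as [r [r1 Hr]].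
  specialize (Hb r r1 Hr). pose proof HA0 as [HA0p [UA0 Up0]]. pose proof Hr as [Hr' _].
  assert (Cr : forall t, continuity_pt r1 t).
  { intros; now apply (sol_continuity (potential w0 (U d0)) r r1). }
  destruct (positive_after r1 A0 (2 * A0)) as [k [Hk Hpk]]; auto; [apply Hb; lra|lra|].
  set (L := A0 + k).
  destruct (continuity_ab_min r1 0 L) as [x [Hx Hx']]; [unfold L; lra|intros; apply Cr|].
  assert (Hm : 0 < r1 x).
  { destruct (Rle_or_lt x A0); [apply Hb; lra|]. apply Hpk. unfold L in Hx'. lra. }
  assert (HUL : U d0 L < 0).
  { rewrite <- UA0. apply (u_decr (U d0) (V d0)) with A0; auto; unfold L; lra. }
  destruct (sine_dependence d0 w0 L (r1 x) r r1 Hd0 Hw0 Hm Hr) as [h1 [Hh1 H1]].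
  destruct (U_dependence d0 L (- U d0 L) Hd0 ltac:(lra)) as [h2 [Hh2 H2]].
  exists (Rmin h1 h2). pose proof (Rmin_l h1 h2). pose proof (Rmin_r h1 h2).
  split; [apply Rmin_pos; lra|]. intros d w A Hd Hw Hdd Hww HA s s1 Hs t Ht.
  assert (AL : A <= L).
  { destruct (Rle_or_lt A L) as [|C]; [easy|exfalso].
    specialize (H2 d Hd ltac:(lra) L ltac:(unfold L; lra)). apply Rabs_def2 in H2.
    destruct HA as [_ [_ HA]]. specialize (HA L ltac:(unfold L in *; lra)). lra. }
  specialize (H1 d w s s1 Hd Hw ltac:(lra) ltac:(lra) Hs t ltac:(lra)).
  apply Rabs_def2 in H1. specialize (Hx t ltac:(lra)). lra.
Qed.

(** On [[0, t0]] the orbit [U d0] is at least [U d0 t0 > 0], so nearby orbits have no zero there;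
    their quarter periods exceed [t0], where [s1] is still negative. *)
Lemma beyond_sine_edge_open (d0 w0 A0 t0 : R) (r r1 : R -> R) :
  0 < d0 -> 0 < w0 -> quarter_period (U d0) A0 -> sine (potential w0 (U d0)) r r1 ->
  0 < t0 < A0 -> r1 t0 < 0 ->
  exists h, 0 < h /\ forall d A, 0 < d -> Rabs (d - d0) < h ->
  quarter_period (U d) A -> ~ below_sine_edge w0 (U d) A.
Proof.
  intros Hd0 Hw0 HA0 Hr Ht0 Hrt.
  assert (HUt : 0 < U d0 t0) by (apply HA0; lra).
  destruct (sine_dependence d0 w0 t0 (- r1 t0) r r1 Hd0 Hw0 ltac:(lra) Hr) as [h1 [Hh1 H1]].
  destruct (U_dependence d0 t0 (U d0 t0) Hd0 HUt) as [h2 [Hh2 H2]].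
  exists (Rmin h1 h2). pose proof (Rmin_l h1 h2). pose proof (Rmin_r h1 h2).
  split; [apply Rmin_pos; lra|]. intros d A Hd Hdd HA Hb.
  destruct (ex_sine d (U d) (V d) Hd (HU d Hd) (U_0 d Hd) (V_0 d Hd) w0 Hw0) as [s [s1 Hs]].
  specialize (Hb s s1 Hs).
  assert (AL : t0 < A).
  { destruct (Rlt_or_le t0 A) as [|C]; [easy|exfalso].
    destruct HA as [HAp [UA _]].
    specialize (H2 d Hd ltac:(lra) A ltac:(lra)). rewrite UA in H2.
    assert (U d0 t0 <= U d0 A).
    { destruct C as [C| -> ]; [|lra]. apply Rlt_le.
      apply (u_decr (U d0) (V d0)) with A0; auto; lra. }
    apply Rabs_def2 in H2. lra. }
  specialize (H1 d w0 s s1 Hd Hw0 ltac:(lra)).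
  rewrite Rminus_diag, Rabs_R0 in H1.
  specialize (H1 Hh1 Hs t0 ltac:(lra)). apply Rabs_def2 in H1.
  specialize (Hb t0 ltac:(lra)). lra.
Qed.

(** Quantifying over the unique quarter period makes the edge a function of [d] alone. The default
    value of [real] at infinity never occurs: the set contains 1 and is bounded by 3. *)
Definition sine_edge (d : R) : R :=
  real (Lub_Rbar (fun w => 0 < w /\ forall A, quarter_period (U d) A -> below_sine_edge w (U d) A)).

(** The set of admissible [w] is downward closed by monotonicity and open, hence consists of the
    positive numbers strictly below its supremum. *)
Lemma sine_edge_spec (d A w : R) :
  0 < d -> quarter_period (U d) A -> 0 < w ->
  (below_sine_edge w (U d) A <-> w < sine_edge d).
Proof.
  intros Hd HA Hw.
  set (E := fun w => 0 < w /\ forall A, quarter_period (U d) A -> below_sine_edge w (U d) A).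
  assert (HE : forall w, 0 < w -> below_sine_edge w (U d) A -> E w).
  { intros x Hx H. split; [easy|]. intros A' HA'.
    now rewrite <- (quarter_period_unique _ _ _ HA HA'). }
  assert (Hub : forall x, E x -> x <= 3).
  { intros x [Hx H]. destruct (Rle_or_lt x 3) as [|C]; [easy|exfalso].
    apply (not_below_sine_edge_3 d (U d) (V d) A) with x; auto. lra. }
  assert (H1 : E 1).
  { apply HE; [lra|]. apply (below_sine_edge_1 d (U d) (V d)); auto. }
  destruct (Lub_Rbar_correct E) as [L1 L2].
  unfold sine_edge. fold E.
  destruct (Lub_Rbar E) as [l| |].
  - simpl in *. split.
    + intros H. destruct (below_sine_edge_open d w A Hd Hw HA H) as [h [Hh Ho]].
      assert (w + h / 2 <= l); [|lra]. apply L1, HE; [lra|].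
      apply Ho; auto; try lra.
      * rewrite Rminus_diag, Rabs_R0. lra.
      * rewrite Rabs_right; lra.
    + intros H. destruct (Classical_Prop.classic (exists x, E x /\ w < x)) as [[x [[Hx HEx] Hwx]]|Hn].
      * apply (below_sine_edge_mono d (U d) (V d) A) with x; auto.
      * exfalso. assert (l <= w); [|lra]. apply (L2 (Finite w)). intros x Hx. simpl.
        destruct (Rle_or_lt x w); [easy|]. exfalso. apply Hn. now exists x.
  - exfalso. apply (L2 (Finite 3)). intros x Hx. now apply Hub.
  - exfalso. apply (L1 1 H1).
Qed.

Lemma ex_quarter (d : R) : 0 < d -> exists A, quarter_period (U d) A.
Proof. intros Hd. apply (ex_quarter_period d (U d) (V d)); auto. Qed.

Lemma sine_edge_gt_1 (d : R) : 0 < d -> 1 < sine_edge d.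
Proof.
  intros Hd. destruct (ex_quarter d Hd) as [A HA].
  apply (sine_edge_spec d A 1); auto; [lra|].
  apply (below_sine_edge_1 d (U d) (V d)); auto.
Qed.

Lemma sine_edge_le_3 (d : R) : 0 < d -> sine_edge d <= 3.
Proof.
  intros Hd. destruct (ex_quarter d Hd) as [A HA].
  destruct (Rle_or_lt (sine_edge d) 3) as [|C]; [easy|exfalso].
  apply (not_below_sine_edge_3 d (U d) (V d) A) with 3; auto; [lra|].
  apply sine_edge_spec; auto; lra.
Qed.

Lemma sine_edge_small (d : R) : 0 < d <= 1 -> sine_edge d <= 1 + energy d / 4.
Proof.
  intros Hd. destruct (ex_quarter d ltac:(lra)) as [A HA].
  assert (0 < energy d).
  { unfold energy. pose proof (pow_lt d 2 ltac:(lra)). pose proof (pow_lt d 4 ltac:(lra)). lra. }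
  destruct (Rle_or_lt (sine_edge d) (1 + energy d / 4)) as [|C]; [easy|exfalso].
  apply (not_below_sine_edge_small d (U d) (V d) A); auto; try lra.
  - apply HU. lra.
  - apply U_0. lra.
  - apply V_0. lra.
  - apply sine_edge_spec; auto; lra.
Qed.

Lemma sine_edge_limit : is_lim sine_edge p_infty 3.
Proof.
  apply is_lim_spec. intros e. simpl.
  set (w := Rmax 2 (3 - e / 2)).
  assert (He := cond_pos e).
  assert (Hw : 1 < w < 3) by (unfold w, Rmax; destruct Rle_dec; lra).
  assert (Hw' : 3 - e / 2 <= w) by apply Rmax_r.
  exists (Rmax 1 (100 / (3 - w))). intros d Hd.
  pose proof (Rmax_l 1 (100 / (3 - w))). pose proof (Rmax_r 1 (100 / (3 - w))).
  assert (Hd0 : 0 < d) by lra.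
  destruct (ex_quarter d Hd0) as [A HA].
  assert (w < sine_edge d).
  { apply (sine_edge_spec d A); auto; [lra|].
    apply (below_sine_edge_large d (U d) (V d)); auto. nra. }
  pose proof (sine_edge_le_3 d Hd0).
  apply Rabs_def1; lra.
Qed.

(** A [w1] just below the edge remains below it and a [w2] just above remains beyond it for all
    nearby amplitudes, which traps the edge between them. *)
Lemma sine_edge_continuous (d0 : R) : 0 < d0 -> continuous sine_edge d0.
Proof.
  intros Hd0. apply continuity_pt_filterlim. intros e He.
  destruct (ex_quarter d0 Hd0) as [A0 HA0].
  pose proof (sine_edge_gt_1 d0 Hd0) as Hg.
  set (w1 := Rmax 1 (sine_edge d0 - e / 2)).
  assert (Hw1 : 1 <= w1 < sine_edge d0 /\ sine_edge d0 - e / 2 <= w1).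
  { unfold w1. split; [|apply Rmax_r]. split; [apply Rmax_l|]. apply Rmax_lub_lt; lra. }
  set (w2 := sine_edge d0 + e / 2).
  destruct (below_sine_edge_open d0 w1 A0) as [h1 [Hh1 H1]]; auto; [lra| |].
  { apply sine_edge_spec; auto; lra. }
  destruct (ex_sine d0 (U d0) (V d0) Hd0 (HU d0 Hd0) (U_0 d0 Hd0) (V_0 d0 Hd0) w2 ltac:(unfold w2; lra))
    as [r [r1 Hr]].
  destruct (beyond_sine_edge d0 (U d0) (V d0) A0 Hd0 (HU d0 Hd0) (U_0 d0 Hd0) (V_0 d0 Hd0) HA0
    (sine_edge d0) w2 r r1) as [t0 [Ht0 Rt0]]; auto.
  { unfold w2. lra. }
  { intros H. apply sine_edge_spec in H; auto; lra. }
  destruct (beyond_sine_edge_open d0 w2 A0 t0 r r1) as [h2 [Hh2 H2]]; auto; [unfold w2; lra|].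
  pose proof (Rmin_l (Rmin h1 h2) d0). pose proof (Rmin_r (Rmin h1 h2) d0).
  pose proof (Rmin_l h1 h2). pose proof (Rmin_r h1 h2).
  exists (Rmin (Rmin h1 h2) d0). split; [repeat apply Rmin_pos; lra|].
  intros d [_ Hd]. change (Rabs (d - d0) < Rmin (Rmin h1 h2) d0) in Hd.
  change (Rabs (sine_edge d - sine_edge d0) < e).
  assert (Hdp : 0 < d).
  { assert (Hd' : Rabs (d - d0) < d0) by lra. apply Rabs_def2 in Hd'. lra. }
  destruct (ex_quarter d Hdp) as [A HA].
  assert (w1 < sine_edge d).
  { apply (sine_edge_spec d A); auto; [lra|]. apply H1; auto; try lra.
    rewrite Rminus_diag, Rabs_R0. lra. }
  assert (sine_edge d <= w2).
  { destruct (Rle_or_lt (sine_edge d) w2) as [|C]; [easy|exfalso].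
    apply (H2 d A); auto; [lra|]. apply (sine_edge_spec d A); auto. unfold w2; lra. }
  unfold w2 in *. apply Rabs_def1; lra.
Qed.

End Family.

(** * The original time variable *)

Lemma hill_solution_sol (q xi : R -> R) : hill_solution q xi -> sol q xi (Derive xi).
Proof.
  intros [H E] t. destruct (H t) as [H1 H2]. split; [now apply Derive_correct|].
  replace (- q t * xi t) with (Derive (Derive xi) t).
  - now apply Derive_correct.
  - specialize (E t). change (Derive (Derive xi) t + q t * xi t = 0) in E. lra.
Qed.

Lemma sol_hill_solution (q y z : R -> R) : sol q y z -> hill_solution q y.
Proof.
  intros H.
  assert (E : forall t, Derive y t = z t) by (intros t; apply is_derive_unique, H).
  assert (E2 : forall t, is_derive (Derive y) t (- q t * y t)).
  { intros t. apply (is_derive_ext z); [intros; now rewrite E|]. exact (proj2 (H t)). }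
  split.
  - intros t. split; eexists; [exact (proj1 (H t))|apply E2].
  - intros t. change (Derive (Derive y) t + q t * y t = 0).
    rewrite (is_derive_unique _ _ _ (E2 t)). ring.
Qed.

Lemma coeff_Mmult_2 (n : nat) (M : @matrix R 2 2) (N : @matrix R 2 n) (i j : nat) :
  (i < 2)%nat -> (j < n)%nat ->
  coeff_mat 0 (Mmult M N) i j =
  coeff_mat 0 M i 0 * coeff_mat 0 N 0 j + coeff_mat 0 M i 1 * coeff_mat 0 N 1 j.
Proof.
  intros Hi Hj. unfold Mmult. rewrite coeff_mat_bij by easy.
  simpl. rewrite sum_Sn, sum_O. reflexivity.
Qed.

Lemma fundamental_matrix_columns (q : R -> R) (Y : R -> @matrix R 2 2) :
  fundamental_matrix q Y ->
  cosine q (fun t => coeff_mat 0 (Y t) 0 0) (fun t => coeff_mat 0 (Y t) 1 0) /\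
  sine q (fun t => coeff_mat 0 (Y t) 0 1) (fun t => coeff_mat 0 (Y t) 1 1).
Proof.
  intros [H0 H].
  assert (Hcol : forall j, (j < 2)%nat ->
    sol q (fun t => coeff_mat 0 (Y t) 0 j) (fun t => coeff_mat 0 (Y t) 1 j)).
  { intros j Hj t. split.
    - assert (D := H t 0%nat j ltac:(lia) Hj). rewrite coeff_Mmult_2 in D by lia.
      replace (coeff_mat 0 (Y t) 1 j) with
        (coeff_mat 0 (hill_system q t) 0 0 * coeff_mat 0 (Y t) 0 j +
         coeff_mat 0 (hill_system q t) 0 1 * coeff_mat 0 (Y t) 1 j); [exact D|].
      change (0 * coeff_mat 0 (Y t) 0 j + 1 * coeff_mat 0 (Y t) 1 j = coeff_mat 0 (Y t) 1 j). ring.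
    - assert (D := H t 1%nat j ltac:(lia) Hj). rewrite coeff_Mmult_2 in D by lia.
      replace (- q t * coeff_mat 0 (Y t) 0 j) with
        (coeff_mat 0 (hill_system q t) 1 0 * coeff_mat 0 (Y t) 0 j +
         coeff_mat 0 (hill_system q t) 1 1 * coeff_mat 0 (Y t) 1 j); [exact D|].
      change (- q t * coeff_mat 0 (Y t) 0 j + 0 * coeff_mat 0 (Y t) 1 j = - q t * coeff_mat 0 (Y t) 0 j). ring. }
  split; (split; [apply Hcol; lia|]); rewrite H0; now split.
Qed.

Definition column_matrix (c c1 s s1 : R -> R) (t : R) : @matrix R 2 2 :=
  mk_matrix 2 2 (fun i j => match i, j with
    | O, O => c t | O, _ => s t | _, O => c1 t | _, _ => s1 t end).

Lemma column_matrix_fundamental (q c c1 s s1 : R -> R) :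
  cosine q c c1 -> sine q s s1 -> fundamental_matrix q (column_matrix c c1 s s1).
Proof.
  intros [Hc [C0 C1]] [Hs [S0 S1]]. split.
  - unfold column_matrix, Mone. apply mk_matrix_ext. intros i j Hi Hj.
    destruct i as [|[|i]]; [| |lia]; (destruct j as [|[|j]]; [| |lia]); simpl;
      rewrite ?C0, ?C1, ?S0, ?S1; reflexivity.
  - intros t i j Hi Hj. rewrite coeff_Mmult_2 by easy.
    destruct (Hc t) as [Dc Dc1], (Hs t) as [Ds Ds1].
    destruct i as [|[|i]]; [| |lia]; (destruct j as [|[|j]]; [| |lia]).
    + apply (is_derive_ext c); [reflexivity|].
      replace (_ + _) with (c1 t); [easy|]. change (c1 t = 0 * c t + 1 * c1 t). ring.
    + apply (is_derive_ext s); [reflexivity|].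
      replace (_ + _) with (s1 t); [easy|]. change (s1 t = 0 * s t + 1 * s1 t). ring.
    + apply (is_derive_ext c1); [reflexivity|].
      replace (_ + _) with (- q t * c t); [easy|].
      change (- q t * c t = - q t * c t + 0 * c1 t). ring.
    + apply (is_derive_ext s1); [reflexivity|].
      replace (_ + _) with (- q t * s t); [easy|].
      change (- q t * s t = - q t * s t + 0 * s1 t). ring.
Qed.

Lemma duffing_solution_derive (d w : R) (Th : R -> R) :
  duffing_solution d w Th -> forall t,
  is_derive Th t (Derive Th t) /\ is_derive (Derive Th) t (- / w * (Th t + Th t ^ 3)).
Proof.
  intros [H [E _]] t. destruct (H t) as [H1 H2]. split; [now apply Derive_correct|].
  replace (- / w * (Th t + Th t ^ 3)) with (Derive (Derive Th) t).
  - now apply Derive_correct.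
  - specialize (E t). change (Derive (Derive Th) t + / w * Th t + / w * Th t ^ 3 = 0) in E. lra.
Qed.

Lemma duffing_solution_rescale (d w k : R) (Th : R -> R) :
  k <> 0 -> w = k ^ 2 -> duffing_solution d w Th ->
  duffing (fun t => Th (k * t + 0)) (fun t => k * Derive Th (k * t + 0)).
Proof.
  intros Hk Hw H t. destruct (duffing_solution_derive d w Th H (k * t + 0)) as [H1 H2]. split.
  - now apply (is_derive_affine Th (Derive Th)).
  - replace (- (Th (k * t + 0) + Th (k * t + 0) ^ 3))
      with (k * (k * (- / w * (Th (k * t + 0) + Th (k * t + 0) ^ 3)))).
    + apply (is_derive_scal (fun t => Derive Th (k * t + 0))).
      now apply (is_derive_affine (Derive Th) (fun t => - / w * (Th t + Th t ^ 3))).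
    + rewrite Hw. field. easy.
Qed.

Lemma minimal_period_unique (f : R -> R) (T T' : R) :
  minimal_period f T -> minimal_period f T' -> T = T'.
Proof.
  intros [P [H1 H2]] [P' [H1' H2']]. apply Rle_antisym; auto.
Qed.

Section Rescaling.

Variables (d w A : R) (Th u v : R -> R).
Hypothesis Hd : 0 < d.
Hypothesis Hw : 0 < w.
Hypothesis HTh : duffing_solution d w Th.
Hypothesis Hu : duffing u v.
Hypothesis u_0 : u 0 = d.
Hypothesis v_0 : v 0 = 0.
Hypothesis HA : quarter_period u A.

Let k := sqrt w.
Let a := k * A.
Let q := hill_potential w Th.

Lemma k_pos : 0 < k.
Proof. now apply sqrt_lt_R0. Qed.

Lemma k_sq : w = k ^ 2.
Proof. unfold k. rewrite pow2_sqrt; lra. Qed.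

Lemma Th_rescale (t : R) : Th t = u (/ k * t).
Proof.
  pose proof k_pos. pose proof HTh as [_ [_ [T0 T1]]].
  destruct (duffing_unique _ _ u v 0 (duffing_solution_rescale d w k Th ltac:(lra) k_sq HTh) Hu)
    with (t := / k * t) as [E _].
  - rewrite Rmult_0_r, Rplus_0_l. congruence.
  - rewrite Rmult_0_r, Rplus_0_l, T1, v_0. ring.
  - rewrite <- E. f_equal. field. lra.
Qed.

Lemma a_pos : 0 < a.
Proof. apply Rmult_lt_0_compat; [apply k_pos|apply HA]. Qed.

(** Written so that half of it is visibly [2 * a], the period of the potential in the symmetric Hill
    equation. *)
Lemma Th_minimal_period : minimal_period Th (2 * (2 * a)).
Proof.
  pose proof k_pos. pose proof a_pos.
  destruct (duffing_minimal_period d u v Hu u_0 v_0 A HA) as [P M].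
  split; [lra|]. split.
  - intros t. rewrite !Th_rescale, <- (P (/ k * t)). f_equal. unfold a. field. lra.
  - intros S HS HP. assert (HS' : 4 * A <= / k * S).
    { apply M.
      - apply Rmult_lt_0_compat; [|easy]. now apply Rinv_0_lt_compat.
      - intros t. specialize (HP (k * t)). rewrite !Th_rescale in HP.
        replace (/ k * (k * t + S)) with (t + / k * S) in HP by (field; lra).
        now replace (/ k * (k * t)) with t in HP by (field; lra). }
    apply (Rmult_le_compat_l k) in HS'; [|lra].
    replace (k * (/ k * S)) with S in HS' by (field; lra). unfold a. lra.
Qed.

Lemma q_rescale (t : R) : (/ k) ^ 2 * potential w u (/ k * t + 0) = q t.
Proof.
  unfold q, hill_potential, potential. rewrite Th_rescale, Rplus_0_r.
  pose proof k_pos. rewrite k_sq. field. lra.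
Qed.

Lemma q_pos (t : R) : 0 < q t.
Proof. unfold q, hill_potential. pose proof (pow2_ge_0 (Th t)). lra. Qed.

Lemma q_bound (t : R) : Rabs (q t) <= w + d ^ 2.
Proof.
  rewrite Rabs_right by (apply Rle_ge, Rlt_le, q_pos).
  unfold q, hill_potential. rewrite Th_rescale.
  pose proof (u_sq_le d u v Hd Hu u_0 v_0 (/ k * t)). lra.
Qed.

Lemma q_even (t : R) : q (- t) = q t.
Proof.
  rewrite <- !q_rescale, !Rplus_0_r.
  replace (/ k * - t) with (- (/ k * t)) by ring.
  now rewrite (potential_even u v Hu v_0).
Qed.

Lemma q_refl (t : R) : q (2 * a - t) = q t.
Proof.
  rewrite <- !q_rescale, !Rplus_0_r.
  replace (/ k * (2 * a - t)) with (2 * A - / k * t)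
    by (unfold a; field; pose proof k_pos; lra).
  now rewrite (potential_refl u v A Hu HA).
Qed.

Lemma cosine_rescale (c c1 : R -> R) :
  cosine (potential w u) c c1 ->
  cosine q (fun t => c (/ k * t + 0)) (fun t => / k * c1 (/ k * t + 0)).
Proof.
  intros [Hc [C0 C1]]. split; [|split].
  - apply (sol_ext _ q _ _ _ _) with (4 := sol_affine _ _ _ (/ k) 0 Hc); try easy.
    apply q_rescale.
  - now rewrite Rmult_0_r, Rplus_0_l.
  - rewrite Rmult_0_r, Rplus_0_l, C1. ring.
Qed.

(** The factor [k] restores slope 1 at 0 after the change of time; the derivative is then [s1]
    unscaled. *)
Lemma sine_rescale (s s1 : R -> R) :
  sine (potential w u) s s1 ->
  sine q (fun t => k * s (/ k * t + 0)) (fun t => s1 (/ k * t + 0)).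
Proof.
  pose proof k_pos. intros [Hs [S0 S1]]. split; [|split].
  - assert (H1 := sol_affine _ _ _ (/ k) 0 Hs).
    apply (sol_ext _ q _ _ _ _) with (4 := sol_lincomb _ _ _ _ _ k 0 H1 H1).
    + apply q_rescale.
    + intros t. ring.
    + intros t. field. lra.
  - rewrite Rmult_0_r, Rplus_0_l, S0. ring.
  - now rewrite Rmult_0_r, Rplus_0_l.
Qed.

Lemma unscale (t : R) : / k * (k * t) + 0 = t.
Proof. pose proof k_pos. field. lra. Qed.

Lemma rescale_interval (P : R -> Prop) :
  (forall t, 0 <= t <= A -> P t) -> forall t, 0 <= t <= a -> P (/ k * t + 0).
Proof.
  pose proof k_pos. intros HP t Ht. apply HP.
  assert (E : t = k * (/ k * t + 0)) by (field; lra).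
  set (r := / k * t + 0) in *. unfold a in Ht. rewrite E in Ht. nra.
Qed.

Section Basis.

Variables (c c1 s s1 : R -> R).
Hypothesis Hc : cosine (potential w u) c c1.
Hypothesis Hs : sine (potential w u) s s1.

Let cq (t : R) := c (/ k * t + 0).
Let cq1 (t : R) := / k * c1 (/ k * t + 0).
Let sq (t : R) := k * s (/ k * t + 0).
Let sq1 (t : R) := s1 (/ k * t + 0).

Lemma half_trace_below_1 : w < 1 -> Rabs (half_trace a cq cq1 sq sq1) < 1.
Proof.
  intros Hw1.
  destruct (cosine_rescale c c1 Hc) as [Hc' [C0 C1]].
  destruct (sine_rescale s s1 Hs) as [Hs' [S0 S1]].
  assert (Hb : below_sine_edge w u A).
  { apply (below_sine_edge_mono d u v A Hd Hu u_0 v_0 HA w 1); [lra|].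
    apply (below_sine_edge_1 d u v); auto. }
  apply (half_trace_stable q a _ _ _ _ a_pos q_pos Hc' Hs' C0 C1 S0 S1).
  - apply (rescale_interval (fun t => 0 < c t)).
    apply (cosine_pos_below_1 d u v A Hd Hu u_0 v_0 HA w c c1); [lra|easy].
  - apply (rescale_interval (fun t => 0 < s1 t)). exact (Hb s s1 Hs).
Qed.

Lemma half_trace_eq_q : half_trace a cq cq1 sq sq1 = 2 * (c A * s1 A) - 1.
Proof.
  destruct (cosine_rescale c c1 Hc) as [Hc' [C0 C1]].
  destruct (sine_rescale s s1 Hs) as [Hs' [S0 S1]].
  etransitivity; [exact (proj1 (half_trace_eq q a _ _ _ _ Hc' Hs' C0 C1 S1))|].
  unfold a. now rewrite unscale.
Qed.

Lemma trace_monodromy (Y : R -> @matrix R 2 2) :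
  fundamental_matrix q Y ->
  trace2 (Y (2 * a)) = 2 * half_trace a cq cq1 sq sq1.
Proof.
  intros HY. destruct (fundamental_matrix_columns q Y HY) as [[Hc2 [E1 E2]] [Hs2 [E3 E4]]].
  destruct (cosine_rescale c c1 Hc) as [Hc' [C0 C1]].
  destruct (sine_rescale s s1 Hs) as [Hs' [S0 S1]].
  destruct (monodromy_diag q (w + d ^ 2) a _ _ _ _ q_bound q_refl Hc' Hs' C0 C1 S0 S1) as [D1 D2].
  unfold trace2.
  rewrite (proj1 (sol_unique q _ _ _ _ (w + d ^ 2) 0 q_bound Hc2 Hc' (eq_trans E1 (eq_sym C0))
    (eq_trans E2 (eq_sym C1)) (2 * a))).
  rewrite (proj2 (sol_unique q _ _ _ _ (w + d ^ 2) 0 q_bound Hs2 Hs' (eq_trans E3 (eq_sym S0))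
    (eq_trans E4 (eq_sym S1)) (2 * a))).
  unfold cq, cq1, sq, sq1. lra.
Qed.

Lemma half_trace_in_tongue :
  1 < w -> below_sine_edge w u A -> half_trace a cq cq1 sq sq1 < -1.
Proof.
  intros Hw1 Hb. specialize (Hb s s1 Hs). rewrite half_trace_eq_q.
  destruct (cosine_zero_above_1 d u v A Hd Hu u_0 v_0 HA w c c1 Hw1 Hc) as [x [Hx Cx]].
  pose proof Hc as [Hc' [C0 C1]]. pose proof Hs as [Hs' [S0 S1]]. pose proof HA as [HA0 _].
  assert (c A < 0).
  { apply (c_neg_after_zero (potential w u) A c c1 s s1 HA0 Hc' Hs' C0 C1 S1 x); auto.
    apply (sine_incr_pos u w s s1 A Hs). intros t Ht. apply Rlt_le, Hb. lra. }
  specialize (Hb A ltac:(lra)). nra.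
Qed.

Lemma exactly_one_zero (mu : R) (xi : R -> R) :
  1 < w -> below_sine_edge w u A -> hill_solution q xi -> (exists t, xi t <> 0) ->
  (forall t, xi (t + 2 * a) = mu * xi t) -> exactly_n_zeros xi 0 (2 * a) 1.
Proof.
  intros Hw1 Hb Hxi Hn Hmu. apply hill_solution_sol in Hxi.
  destruct (cosine_rescale c c1 Hc) as [Hc' [C0 C1]].
  destruct (sine_rescale s s1 Hs) as [Hs' [S0 S1]].
  assert (HD := half_trace_in_tongue Hw1 Hb).
  specialize (Hb s s1 Hs).
  destruct (tongue_unique_zero q (w + d ^ 2) a _ _ _ _ a_pos q_bound q_even q_refl Hc' Hs' C0 C1 S0 S1
    xi (Derive xi) mu) as [x [Hx [Xx Hux]]]; auto.
  - now apply (rescale_interval (fun t => 0 < s1 t)).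
  - exists (x :: nil). split; [|split; [easy|]].
    + constructor; [easy|constructor].
    + intros t. split.
      * intros [<-|[]]. easy.
      * intros [Ht Xt]. left. symmetry. now apply Hux.
Qed.

(** The eigenvector is [(sq (2 * a), mu - D)]. Its first row is immediate from the diagonal entry
    [D]; the second combines determinant 1 with the characteristic equation. *)
Lemma monodromy_eigenvalue (Y : R -> @matrix R 2 2) (mu : R) :
  let D := half_trace a cq cq1 sq sq1 in
  fundamental_matrix q Y -> mu ^ 2 + 1 = 2 * D * mu -> sq (2 * a) <> 0 ->
  real_eigenvalue (Y (2 * a)) mu.
Proof.
  intros D HY Hmu Hsn.
  destruct (fundamental_matrix_columns q Y HY) as [[Hc2 [E1 E2]] [Hs2 [E3 E4]]].
  destruct (cosine_rescale c c1 Hc) as [Hc' [C0 C1]].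
  destruct (sine_rescale s s1 Hs) as [Hs' [S0 S1]].
  destruct (monodromy_diag q (w + d ^ 2) a _ _ _ _ q_bound q_refl Hc' Hs' C0 C1 S0 S1) as [D1 D2].
  assert (W := wronskian_basis q _ _ _ _ Hc' Hs' C0 C1 S1 (2 * a)).
  destruct (sol_unique q _ _ _ _ (w + d ^ 2) 0 q_bound Hc2 Hc' (eq_trans E1 (eq_sym C0))
    (eq_trans E2 (eq_sym C1)) (2 * a)) as [F1 F2].
  destruct (sol_unique q _ _ _ _ (w + d ^ 2) 0 q_bound Hs2 Hs' (eq_trans E3 (eq_sym S0))
    (eq_trans E4 (eq_sym S1)) (2 * a)) as [F3 F4].
  cbv beta in W, F1, F2, F3, F4.
  change (c (/ k * (2 * a) + 0)) with (cq (2 * a)) in *.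
  change (/ k * c1 (/ k * (2 * a) + 0)) with (cq1 (2 * a)) in *.
  change (k * s (/ k * (2 * a) + 0)) with (sq (2 * a)) in *.
  change (s1 (/ k * (2 * a) + 0)) with (sq1 (2 * a)) in *.
  change (cq (2 * a) = D) in D1. change (sq1 (2 * a) = D) in D2.
  rewrite D1, D2 in W. rewrite D1 in F1. rewrite D2 in F4.
  exists (mk_matrix 2 1 (fun i _ => match i with O => sq (2 * a) | _ => mu - D end)). split.
  - intros E. apply Hsn. apply (f_equal (fun v => coeff_mat 0 v 0 0)) in E. exact E.
  - unfold Mmult. apply mk_matrix_ext. intros i j Hi Hj.
    assert (j = 0%nat) by lia. subst j. simpl pred. rewrite sum_Sn, sum_O.
    destruct i as [|[|i]]; [| |lia].
    + change (coeff_mat 0 (Y (2 * a)) 0 0 * sq (2 * a) + coeff_mat 0 (Y (2 * a)) 0 1 * (mu - D)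
        = mu * sq (2 * a)). rewrite F1, F3. ring.
    + change (coeff_mat 0 (Y (2 * a)) 1 0 * sq (2 * a) + coeff_mat 0 (Y (2 * a)) 1 1 * (mu - D)
        = mu * (mu - D)). rewrite F2, F4. nra.
Qed.

(** The alternative [s1 A = 0] gives trace [-2], excluded by the strict hypothesis. In the other
    case the zero of [c] and the point with [s1 < 0], rescaled by [k], feed [beyond_tongue]. *)
Lemma beyond_sine_edge_zeros (Y : R -> @matrix R 2 2) :
  1 < w -> ~ below_sine_edge w u A -> fundamental_matrix q Y ->
  2 < Rabs (trace2 (Y (2 * a))) ->
  exists mu xi, real_eigenvalue (Y (2 * a)) mu /\ hill_solution q xi /\
    (exists t, xi t <> 0) /\ (forall t, xi (t + 2 * a) = mu * xi t) /\
    ~ exactly_n_zeros xi 0 (2 * a) 1.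
Proof.
  intros Hw1 Hb HY HT. rewrite (trace_monodromy Y HY), Rabs_mult, (Rabs_right 2) in HT by lra.
  pose proof k_pos.
  destruct (cosine_zero_above_1 d u v A Hd Hu u_0 v_0 HA w c c1 Hw1 Hc) as [x1 [Hx1 Cx1]].
  destruct (sine_edge_dichotomy d u v A Hd Hu u_0 v_0 w s s1 Hw Hs Hb) as [SA|[t0 [Ht0 St0]]].
  { rewrite half_trace_eq_q, SA, Rmult_0_r, Rmult_0_r, Rabs_left in HT; lra. }
  destruct (cosine_rescale c c1 Hc) as [Hc' [C0 C1]].
  destruct (sine_rescale s s1 Hs) as [Hs' [S0 S1]].
  destruct (beyond_tongue q (w + d ^ 2) a _ _ _ _ a_pos q_bound q_pos q_even q_refl Hc' Hs'
    C0 C1 S0 S1 (k * x1) (k * t0)) as [mu [y [z [Hy [Hsn [E [Hn [Hmu Hz]]]]]]]].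
  - unfold a. nra.
  - now rewrite unscale.
  - unfold a. nra.
  - now rewrite unscale.
  - change (1 < Rabs (half_trace a cq cq1 sq sq1)). lra.
  - exists mu, y. split; [|split; [|split; [|split]]]; auto.
    + now apply monodromy_eigenvalue.
    + now apply (sol_hill_solution q y z).
    + intros [l [_ [Hl HI]]].
      destruct l as [|x [|]]; try discriminate.
      destruct (proj1 (HI x) (or_introl eq_refl)) as [Hx Yx].
      destruct (Hz x Hx Yx) as [x' [Hx' [Yx' N]]].
      destruct (proj2 (HI x') (conj Hx' Yx')) as [|[]]. now apply N.
Qed.

End Basis.

Lemma stable_below_1 : w < 1 -> stable q.
Proof.
  intros Hw1 xi Hxi. apply hill_solution_sol in Hxi.
  destruct (ex_cosine d u v Hd Hu u_0 v_0 w Hw) as [c [c1 Hc]].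
  destruct (ex_sine d u v Hd Hu u_0 v_0 w Hw) as [s [s1 Hs]].
  destruct (cosine_rescale c c1 Hc) as [Hc' [C0 C1]].
  destruct (sine_rescale s s1 Hs) as [Hs' [S0 S1]].
  apply (bounded_of_half_trace q (w + d ^ 2) a _ _ _ _ a_pos q_bound q_even q_refl Hc' Hs' C0 C1 S0 S1
     xi (Derive xi) Hxi).
  now apply half_trace_below_1.
Qed.

End Rescaling.

(** * Identification of the tongue and conclusion *)

Lemma resonant_tongue_iff (Theta : R -> R -> R -> R) (d w A : R) (u v : R -> R) :
  0 < d -> 0 < w -> duffing_solution d w (Theta d w) ->
  duffing u v -> u 0 = d -> v 0 = 0 -> quarter_period u A ->
  (resonant_tongue Theta 1 d w <-> 1 < w /\ below_sine_edge w u A).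
Proof.
  intros Hd Hw HTh Hu U0 V0 HA.
  assert (HP := Th_minimal_period d w A (Theta d w) u v Hw HTh Hu U0 V0 HA).
  set (a := sqrt w * A) in *.
  destruct (ex_cosine d u v Hd Hu U0 V0 w Hw) as [c [c1 Hc]].
  destruct (ex_sine d u v Hd Hu U0 V0 w Hw) as [s [s1 Hs]].
  assert (Hhalf : 2 * (2 * a) / 2 = 2 * a) by field.
  split.
  - intros [_ [_ [T [Y HT]]]]. cbv zeta in HT. destruct HT as [HT [HY [Htr Hz]]].
    rewrite (minimal_period_unique _ _ _ HT HP), Hhalf in *.
    assert (HD := Htr). unfold a in HD.
    rewrite (trace_monodromy d w A (Theta d w) u v Hd Hw HTh Hu U0 V0 HA c c1 s s1 Hc Hs Y HY) in HD.
    rewrite Rabs_mult, (Rabs_right 2) in HD by lra.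
    (* Below 1 the half trace is less than 1 in modulus; at 1, [c A = 0] makes it exactly [-1].
       Neither is compatible with a trace beyond 2 in modulus. *)
    destruct (Rtotal_order w 1) as [L|[L|L]].
    + exfalso.
      pose proof (half_trace_below_1 d w A (Theta d w) u v Hd Hw HTh Hu U0 V0 HA c c1 s s1 Hc Hs L). lra.
    + exfalso.
      rewrite (half_trace_eq_q d w A (Theta d w) u v Hw HTh Hu U0 V0 c c1 s s1 Hc Hs) in HD.
      rewrite L in Hc. rewrite (cosine_at_1 u v A Hu V0 HA c c1 Hc), Rmult_0_l, Rmult_0_r, Rabs_left in HD; lra.
    + split; [easy|].
      destruct (Classical_Prop.classic (below_sine_edge w u A)) as [|Hb]; [easy|exfalso].
      destruct (beyond_sine_edge_zeros d w A (Theta d w) u v Hd Hw HTh Hu U0 V0 HA c c1 s s1 Hc Hs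
        Y L Hb HY Htr) as [mu [xi [H1 [H2 [H3 [H4 H5]]]]]].
      apply H5. now apply (Hz mu xi).
  - intros [Hw1 Hb]. split; [easy|]. split; [easy|].
    destruct (cosine_rescale d w (Theta d w) u v Hw HTh Hu U0 V0 c c1 Hc) as [Hc' C].
    destruct (sine_rescale d w (Theta d w) u v Hw HTh Hu U0 V0 s s1 Hs) as [Hs' S].
    assert (HY := column_matrix_fundamental _ _ _ _ _ (conj Hc' C) (conj Hs' S)).
    exists (2 * (2 * a)). eexists. cbv zeta. rewrite Hhalf.
    split; [easy|]. split; [exact HY|]. split.
    + assert (E := trace_monodromy d w A (Theta d w) u v Hd Hw HTh Hu U0 V0 HA c c1 s s1 Hc Hs _ HY).
      assert (HD := half_trace_in_tongue d w A (Theta d w) u v Hd Hw HTh Hu U0 V0 HA c c1 s s1 Hc Hs Hw1 Hb).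
      fold a in E, HD. rewrite E, Rabs_left; lra.
    + intros mu xi _ Hxi Hn Hmu.
      now apply (exactly_one_zero d w A (Theta d w) u v Hd Hw HTh Hu U0 V0 HA c c1 s s1 Hc Hs mu).
Qed.

Theorem theorem13 (Theta : R -> R -> R -> R)
  (HTheta : forall delta omega : R, 0 < delta -> 0 < omega ->
     duffing_solution delta omega (Theta delta omega)) :
  (exists phi : R -> R,
     (forall delta : R, 0 < delta -> 0 < phi delta) /\
     (forall delta : R, 0 < delta -> continuous phi delta) /\
     (forall delta omega : R,
        resonant_tongue Theta 1 delta omega <->
        (0 < delta /\ 0 < omega) /\ (1 < omega < phi delta)) /\
     (forall delta : R, 0 < delta -> 1 < phi delta) /\
     (exists C delta0 : R, 0 < C /\ 0 < delta0 /\
        forall delta : R, 0 < delta < delta0 ->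
          phi delta <= 1 + (1 / 8 + 1 / (2 * PI)) * delta ^ 2 + C * delta ^ 4) /\
     is_lim phi p_infty 3) /\
  (forall delta omega : R, 0 < delta -> 0 < omega < 1 ->
     stable (hill_potential omega (Theta delta omega))).
Proof.
  (* At [omega = 1] the original and the rescaled time coincide, so the given family itself supplies
     the orbit; the form [1 * t + 0] is that of [duffing_solution_rescale] with [k = 1]. *)
  set (U := fun d t => Theta d 1 (1 * t + 0)).
  set (V := fun d t => 1 * Derive (Theta d 1) (1 * t + 0)).
  assert (HU : forall d, 0 < d -> duffing (U d) (V d)).
  { intros d Hd. apply (duffing_solution_rescale d 1 1); [lra|ring|]. apply HTheta; lra. }
  assert (U0 : forall d, 0 < d -> U d 0 = d).
  { intros d Hd. unfold U. rewrite Rmult_0_r, Rplus_0_l. apply HTheta; lra. }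
  assert (V0 : forall d, 0 < d -> V d 0 = 0).
  { intros d Hd. unfold V. rewrite Rmult_0_r, Rplus_0_l, Rmult_1_l. apply (HTheta d 1); lra. }
  assert (Hg := sine_edge_gt_1 U V HU U0 V0).
  split.
  - exists (sine_edge U). split; [|split; [|split; [|split; [|split]]]].
    + intros d Hd. specialize (Hg d Hd). lra.
    + exact (sine_edge_continuous U V HU U0 V0).
    + assert (Hiff : forall d w, 0 < d -> 0 < w ->
        (resonant_tongue Theta 1 d w <-> 1 < w < sine_edge U d)).
      { intros d w Hd Hw. destruct (ex_quarter U V HU U0 V0 d Hd) as [A HA].
        rewrite (resonant_tongue_iff Theta d w A (U d) (V d)); auto.
        now rewrite (sine_edge_spec U V HU U0 V0 d A w). }
      intros d w. split.
      * intros H. pose proof H as [Hd [Hw _]]. split; [easy|]. now apply Hiff.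
      * intros [[Hd Hw] H]. now apply Hiff.
    + exact Hg.
    + exists 1, 1. split; [lra|]. split; [lra|]. intros d Hd.
      pose proof (sine_edge_small U V HU U0 V0 d ltac:(lra)) as H. unfold energy in H.
      (* From [PI <= 4]. Hence the coefficient [1 / 4] of [energy d / 4] is at most
         [1 / 8 + 1 / (2 * PI)], and its quartic part [d ^ 4 / 8] fits under [C = 1]. *)
      assert (HPI : 1 / 8 <= 1 / (2 * PI)).
      { apply Rmult_le_compat_l; [lra|]. pose proof PI_4. pose proof PI_RGT_0.
        apply Rinv_le_contravar; lra. }
      pose proof (pow_lt d 2 ltac:(lra)). pose proof (pow_lt d 4 ltac:(lra)). nra.
    + exact (sine_edge_limit U V HU U0 V0).
  - intros d w Hd Hw. destruct (ex_quarter U V HU U0 V0 d Hd) as [A HA].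
    apply (stable_below_1 d w A (Theta d w) (U d) (V d)); auto; try lra. apply HTheta; lra.
Qed.
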